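(* Let $X=\{x_0\}\cup\bigcup_{n=1}^\infty K_n$ be the compact plane set constructed in the context, where the $K_n$ are closures of slit domains, placed side by side and tapering on the right to the point $x_0$, and the slits in each $K_n$ accumulate on the whole of the left edge of $K_n$. Then $\{x_0\}$ is the only point of continuity for $R(X)$ (that is, $x_0$ is a point of continuity and there are no others), while $R(X)$ has no R-points.
   Context: Construction of $X$. Identify $\mathbb{C}$ with $\mathbb{R}^2$. Let $a_1<a_2<\cdots$ be real numbers increasing to a real number, regarded as the point $x_0=(\lim_n a_n,0)$. Let $T$ be a closed right-angled triangle with vertices $(a_1,0)$, $(a_1,h)$ and $x_0$, where $h>0$. For $n\in\mathbb{N}$ let $F_n=\{(s,t)\in T: a_n\le s\le a_{n+1}\}$, a closed trapezoid with a horizontal bottom edge, vertical left and right edges, and a sloping top edge. The right edge of $F_n$ is the left edge of $F_{n+1}$, and the $F_n$ taper and accumulate on the right at $x_0$. The set $K_n$ is obtained from $F_n$ by cutting a sequence of thin slits downwards from the top edge. Each slit is a triangle with its base on the top edge and its tip in the interior of $F_n$, and what is removed is the interior of this triangle together with the open base segment. The closed triangles are pairwise disjoint and do not meet the left or right edge of $F_n$. They are ordered from right to left and become thinner and longer (reaching lower and lower), with their bases shrinking to the top left corner of $F_n$ and their tips tending to the bottom left corner of $F_n$, so that the slits accumulate exactly on the whole of the line segment forming the left edge of $K_n$. Each $K_n$ is compact, and consecutive $K_n$ touch along the full common vertical edge. Set $X=\{x_0\}\cup\bigcup_{n=1}^\infty K_n$. Definitions. A compact plane set is a non-empty compact subset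 of $\mathbb{C}$. For a compact plane set $X$, $C(X)$ denotes the algebra of all continuous functions $X\to\mathbb{C}$, and $R(X)$ denotes the set of all $f\in C(X)$ which can be uniformly approximated on $X$ by rational functions with no poles on $X$. (With the uniform norm, $R(X)$ is a uniform algebra which is natural on $X$, i.e. its only characters are the evaluations at points of $X$.) For $x\in X$, let $J_x$ be the ideal of all $f\in R(X)$ such that $x$ lies in the interior (relative to $X$) of the zero set $f^{-1}(\{0\})$, and let $M_x=\{f\in R(X): f(x)=0\}$. A point $x\in X$ is a point of continuity for $R(X)$ if for all $y\in X\setminus\{x\}$ we have $J_y\not\subseteq M_x$. A point $x\in X$ is an R-point for $R(X)$ if for all $y\in X\setminus\{x\}$ we have $J_x\not\subseteq M_y$. *)

(* Defs.v *)
From HB Require Import structures.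
From mathcomp Require Import all_boot all_order all_algebra.
From mathcomp Require Import all_classical all_reals all_analysis.
From mathcomp Require Import complex.

Set Implicit Arguments.
Unset Strict Implicit.
Unset Printing Implicit Defensive.

Import Order.TTheory GRing.Theory Num.Theory.
Import numFieldNormedType.Exports.

Local Open Scope classical_set_scope.
Local Open Scope ring_scope.
Local Open Scope complex_scope.

(* [R[i]] carries no topology in the libraries; this gives it the one induced
   by the modulus, as [numFieldNormedType] does for abstract number fields. *)
HB.instance Definition _ (R : rcfType) := NormedModule.copy R[i] R[i]^o.

Section UniformAlgebra.
Variables (R : realType) (X : set R[i]).

(* Functions on X are represented by total functions R[i] -> R[i]; none of the
   notions below depends on the values taken outside X. *)
Definition contfun : set (R[i] -> R[i]) := [set f | {within X, continuous f}].

Definition ratfun : set (R[i] -> R[i]) :=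
  [set f | contfun f /\ forall e : R, 0 < e ->
     exists p q : {poly R[i]},
       (forall z, X z -> q.[z] != 0) /\
       (forall z, X z -> `|f z - p.[z] / q.[z]| < e%:C)].

Definition idealJ (x : R[i]) : set (R[i] -> R[i]) :=
  [set f | ratfun f /\ \forall z \near within X (nbhs x), f z = 0].

Definition idealM (x : R[i]) : set (R[i] -> R[i]) :=
  [set f | ratfun f /\ f x = 0].

Definition point_of_continuity (x : R[i]) : Prop :=
  X x /\ forall y, X y -> y <> x -> ~ (idealJ y `<=` idealM x).

Definition R_point (x : R[i]) : Prop :=
  X x /\ forall y, X y -> y <> x -> ~ (idealJ x `<=` idealM y).

End UniformAlgebra.

Section PlaneFigures.
Variable R : realType.

(* Closed (filled) triangle, i.e. the convex hull of its three vertices. *)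
Definition triangle (p q r : R[i]) : set R[i] :=
  [set z | exists u v w : R,
     [/\ 0 <= u, 0 <= v, 0 <= w, u + v + w = 1
       & z = u%:C * p + v%:C * q + w%:C * r]].

Definition open_segment (p q : R[i]) : set R[i] :=
  [set z | exists2 t : R, 0 < t < 1 & z = (1 - t)%:C * p + t%:C * q].

End PlaneFigures.

Section SlitDomains.
(* Sequences are indexed from 0: [a 0] is the first point of the sequence. *)
Variables (R : realType) (a : nat -> R) (x0 h : R).

Definition bigT : set R[i] := triangle (a 0 +i* 0) (a 0 +i* h) (x0 +i* 0).

Definition trapezoid (n : nat) : set R[i] :=
  [set z | bigT z /\ a n <= complex.Re z <= a n.+1].

(* Left edge of [trapezoid n], right edge of [trapezoid n.-1]. *)
Definition vedge (n : nat) : set R[i] :=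
  [set z | bigT z /\ complex.Re z = a n].

(* Point of abscissa [s] on the hypotenuse of [bigT]; the top edge of
   [trapezoid n] is traced by [a n <= s <= a n.+1]. *)
Definition slope (s : R) : R[i] := s +i* (h * (x0 - s) / (x0 - a 0)).

(* A slit is given by the abscissas [l < r] of the ends of its base, which lies
   on the hypotenuse, and by its tip [w]. *)
Definition slit (l r : R) (w : R[i]) : set R[i] :=
  triangle (slope l) (slope r) w.

Definition slit_removed (l r : R) (w : R[i]) : set R[i] :=
  (slit l r w)° `|` open_segment (slope l) (slope r).

Record slit_sequence (n : nat) (l r : nat -> R) (w : nat -> R[i]) : Prop :=
  SlitSequence {
    slit_base : forall k, [/\ a n <= l k, l k < r k & r k <= a n.+1];
    slit_tip : forall k, (trapezoid n)° (w k);
    slit_disjoint : trivIset setT (fun k => slit (l k) (r k) (w k));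
    slit_left : forall k, slit (l k) (r k) (w k) `&` vedge n = set0;
    slit_right : forall k, slit (l k) (r k) (w k) `&` vedge n.+1 = set0;
    slit_ordered : forall k, r k.+1 < l k;
    slit_thinner : forall k, r k.+1 - l k.+1 < r k - l k;
    slit_lower : forall k, complex.Im (w k.+1) < complex.Im (w k);
    slit_base_left_cvg : slope (l k) @[k --> \oo] --> slope (a n);
    slit_base_right_cvg : slope (r k) @[k --> \oo] --> slope (a n);
    slit_tip_cvg : w k @[k --> \oo] --> (a n +i* 0 : R[i])
  }.

Definition slitK (n : nat) (l r : nat -> R) (w : nat -> R[i]) : set R[i] :=
  trapezoid n `\` \bigcup_k slit_removed (l k) (r k) (w k).

Definition slitX (l r : nat -> nat -> R) (w : nat -> nat -> R[i]) : set R[i] :=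
  [set x0 +i* 0] `|` \bigcup_n slitK n (l n) (r n) (w n).

End SlitDomains.

(* Main.v *)
Require Import Defs.
From mathcomp Require Import all_boot all_order all_algebra.
From mathcomp Require Import all_classical all_reals all_analysis.
From mathcomp Require Import complex.
From mathcomp Require Import ring lra.

(** Why it is true.

    Two mechanisms are at work, one for each direction of travel through [X].

    - Zeros travel to the left. Let [f] belong to [R(X)] and vanish near a point
    of the piece [K_n]. The interior of [K_n] contains a connected dense open
    set, the open trapezoid minus its slits ([slit_domain_connected],
    [slitK_closure]), on which [f] is a locally uniform limit of rational
    functions; hence [f] vanishes on [K_n] ([zero_on_disc]). The right edge of
    [K_m], for [m.+1 = n], lies in [K_n] and is a free boundary arc of [K_m], so
    [f] also vanishes on [K_m] ([zero_at_square_center]), and so on down to the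
    first piece. All of this rests on the maximum principle for rational
    functions. Consequently any two points [x], [y] of the same piece satisfy
    [J_x <= M_y], and [J_{x0} <= M_y] for every [y]: no point but [x0] can be a
    point of continuity, and no point is an R-point.

    - Zeros do not travel to the right. Below the tip of each slit of [K_n] a gate
    is left open, and the gates shrink to the lower left corner of [K_n]. On the
    line through a slit, everything but a short segment around the gate lies off
    [X]; the complement of the rest of that line is mapped onto a disc by an
    inverse Joukowski map ([rapprox_joukowski]), which is a limit of rational
    functions. This gives for each slit a function of [R(X)] with values in the
    right half-plane, close to [0] on the far right of the gate and with real part
    bounded below on its left ([exists_gate]). For a sparse sequence [h_j] of such
    functions, [1 / (1 + h_0 + h_1 + ...)] converges uniformly on [X], vanishes to
    the left of the left edge of [K_n] and not at [x0] ([rapprox_vanishing],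
    [exists_peak]). So [J_y] is not contained in [M_{x0}] for [y] in an earlier
    piece: [x0] is a point of continuity. *)

Import Order.TTheory GRing.Theory Num.Theory.
Import numFieldNormedType.Exports.
Import Normc.

Set Implicit Arguments.
Unset Strict Implicit.
Unset Printing Implicit Defensive.

Local Open Scope classical_set_scope.
Local Open Scope ring_scope.
Local Open Scope complex_scope.

(** * Modulus and topology of the complex plane *)

Section Modulus.
Variable R : realType.
Implicit Types (z x y : R[i]) (X : set R[i]).

Lemma normC_normc z : `|z| = (normc z)%:C.
Proof. by case: z. Qed.

Lemma normcD x y : normc (x + y) <= normc x + normc y.
Proof. by have := ler_normD x y; rewrite !normC_normc -rmorphD lecR. Qed.

Lemma normc_ge0 z : 0 <= normc z.
Proof. by have := normr_ge0 z; rewrite normC_normc (lecR 0). Qed.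

Lemma normc_opp z : normc (- z) = normc z.
Proof. exact: normcN. Qed.

Lemma normc_distC x y : normc (x - y) = normc (y - x).
Proof. by rewrite -normc_opp opprB. Qed.

Lemma normcX z n : normc (z ^+ n) = normc z ^+ n.
Proof. by apply: complexI; rewrite -!normC_normc normrX normC_normc rmorphXn. Qed.

Lemma normc_eq0 z : (normc z == 0) = (z == 0).
Proof.
by apply/eqP/eqP => [/eq0_normc //|->]; rewrite normc0.
Qed.

Lemma normc_gt0 z : (0 < normc z) = (z != 0).
Proof. by rewrite lt_def normc_ge0 andbT normc_eq0. Qed.

Lemma normc_real (a : R) : normc a%:C = `|a|.
Proof. by rewrite /= expr0n /= addr0 sqrtr_sqr. Qed.

Lemma normc_two : normc (2 : R[i]) = 2.
Proof. by rewrite -(rmorph_nat (real_complex R)) normc_real ger0_norm. Qed.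

Lemma sqr_normcE z : normc z ^+ 2 = complex.Re z ^+ 2 + complex.Im z ^+ 2.
Proof. by case: z => a b /=; rewrite sqr_sqrtr // addr_ge0 ?sqr_ge0. Qed.

Lemma Re_le_normc z : `|complex.Re z| <= normc z.
Proof.
rewrite -(ler_pXn2r (n := 2)) ?nnegrE ?normr_ge0 ?normc_ge0 //.
by rewrite sqr_normcE real_normK ?num_real // lerDl sqr_ge0.
Qed.

Lemma Re_ge1_normcV z : 1 <= complex.Re z -> normc z^-1 <= 1.
Proof.
move=> z1; rewrite normcV invf_le1; last first.
  by have := Re_le_normc z; have := ler_norm (complex.Re z); lra.
by have := Re_le_normc z; have := ler_norm (complex.Re z); lra.
Qed.

Lemma Im_le_normc z : `|complex.Im z| <= normc z.
Proof.
rewrite -(ler_pXn2r (n := 2)) ?nnegrE ?normr_ge0 ?normc_ge0 //.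
by rewrite sqr_normcE real_normK ?num_real // lerDr sqr_ge0.
Qed.

Lemma normc_le_ReIm z : normc z <= `|complex.Re z| + `|complex.Im z|.
Proof.
rewrite {1}[z]complexE; apply: le_trans (normcD _ _) _.
rewrite normcM !normc_real.
have -> : normc ('i%C : R[i]) = 1 by rewrite /= expr0n expr1n add0r sqrtr1.
by rewrite mul1r.
Qed.

Lemma normc_small (x : R[i]) (e : R) : 0 < e ->
  exists2 t : R, 0 < t & forall s, 0 < s <= t -> normc (s%:C * x) < e.
Proof.
move=> e0; have n0 : 0 < normc x + 1 by have := normc_ge0 x; lra.
exists (e / (normc x + 1)); first exact: divr_gt0.
move=> s /andP[s0 st]; rewrite normcM normc_real gtr0_norm //.
move: st; rewrite ler_pdivlMr // => st; apply: lt_le_trans st.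
by rewrite ltr_pM2l //; lra.
Qed.

Lemma Im_quotient x d : d != 0 -> complex.Im (x / d) * normc d ^+ 2 =
  complex.Im x * complex.Re d - complex.Re x * complex.Im d.
Proof.
move=> d0; have {2 3}-> : x = x / d * d by rewrite divfK.
rewrite sqr_normcE; case: (x / d) => u v; case: d {d0} => p q /=; ring.
Qed.

Lemma nbhs_normcP z (A : set R[i]) :
  nbhs z A <-> exists2 e : R, 0 < e & forall z', normc (z' - z) < e -> A z'.
Proof.
split.
- move=> /nbhs_ballP[e /= e0 h].
  have eR : e = (complex.Re e)%:C by rewrite RRe_real // gtr0_real.
  exists (complex.Re e); first by rewrite -ltcR -eR.
  move=> z' hz; apply: h.
  by rewrite -ball_normE /= distrC eR normC_normc ltcR.
- move=> [e e0 h]; apply/nbhs_ballP; exists e%:C; first by rewrite /= ltcR.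
  move=> z'; rewrite -ball_normE /= distrC normC_normc ltcR; exact: h.
Qed.

Lemma within_normcP X z (P : set R[i]) :
  (\forall z' \near within X (nbhs z), P z') <->
  exists2 e : R, 0 < e & forall z', X z' -> normc (z' - z) < e -> P z'.
Proof.
rewrite /prop_near1 /within /=; split.
- by move=> /nbhs_normcP[e e0 h]; exists e => // z' Xz /h; apply.
- by move=> [e e0 h]; apply/nbhs_normcP; exists e => // z' hz Xz; apply: h.
Qed.

Lemma continuous_normcP X (f : R[i] -> R[i]) :
  {within X, continuous f} <-> forall z, X z -> forall e : R, 0 < e ->
    exists2 d : R, 0 < d & forall z', X z' -> normc (z' - z) < d ->
       normc (f z' - f z) < e.
Proof.
rewrite subspace_continuousP; split.
- move=> fc z Xz e e0.
  have /(fc z Xz) : nbhs (f z) [set w | normc (w - f z) < e].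
    by apply/nbhs_normcP; exists e.
  by move=> /within_normcP.
- move=> h z Xz A /nbhs_normcP[e e0 eA]; apply/within_normcP.
  by have [d d0 hd] := h z Xz e e0; exists d => // z' Xz' /hd - /(_ Xz')/eA.
Qed.

Lemma cvg_eventuallyC (u : nat -> R[i]) (c : R[i]) : u k @[k --> \oo] --> c ->
  forall e : R, 0 < e -> exists N, forall k, (N <= k)%N -> normc (u k - c) < e.
Proof.
move=> uc e e0.
have /uc[N _ hN] : nbhs c [set z | normc (z - c) < e] by apply/nbhs_normcP; exists e.
by exists N => k /hN.
Qed.

Lemma open_normcP (A : set R[i]) : open A <->
  forall z, A z -> exists2 e : R, 0 < e & forall z', normc (z' - z) < e -> A z'.
Proof.
rewrite openE; split=> h z Az; first by apply/nbhs_normcP/h.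
by apply/nbhs_normcP/h.
Qed.

Lemma continuous_ReC : continuous (@complex.Re R).
Proof.
move=> z A /nbhs_ballP[e /= e0 eA]; apply/nbhs_normcP; exists e => // z' hz.
apply: eA; rewrite -ball_normE /= distrC.
apply: le_lt_trans hz; have := Re_le_normc (z' - z).
by case: z' z => [? ?] [? ?].
Qed.

Lemma continuous_ImC : continuous (@complex.Im R).
Proof.
move=> z A /nbhs_ballP[e /= e0 eA]; apply/nbhs_normcP; exists e => // z' hz.
apply: eA; rewrite -ball_normE /= distrC.
apply: le_lt_trans hz; have := Im_le_normc (z' - z).
by case: z' z => [? ?] [? ?].
Qed.

Lemma normc_dist x y : `|normc x - normc y| <= normc (x - y).
Proof.
have h1 := normcD (x - y) y; have h2 := normcD (y - x) x.
rewrite ler_norml; move: h1 h2; rewrite !subrK (normc_distC y x); lra.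
Qed.

Lemma continuous_normc : continuous (@normc R).
Proof.
move=> z A /nbhs_ballP[e /= e0 eA]; apply/nbhs_normcP; exists e => // z' hz.
apply: eA; rewrite -ball_normE /= distrC.
exact: le_lt_trans (normc_dist _ _) hz.
Qed.

Lemma continuous_normcB u : continuous (fun z => normc (z - u)).
Proof.
move=> z A /nbhs_ballP[e /= e0 eA]; apply/nbhs_normcP; exists e => // z' hz.
apply: eA; rewrite -ball_normE /= distrC.
apply: le_lt_trans (normc_dist _ _) _.
by rewrite (_ : z' - u - (z - u) = z' - z) //; ring.
Qed.

Lemma closed_le_continuous (phi : R[i] -> R) (b : R) : continuous phi ->
  closed [set z | phi z <= b].
Proof.
move=> cphi; apply: (@preimage_closed _ _ phi [set t | t <= b]) => [z _|].
  exact: cphi.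
exact: closed_le.
Qed.

Lemma closed_ge_continuous (phi : R[i] -> R) (b : R) : continuous phi ->
  closed [set z | b <= phi z].
Proof.
move=> cphi; apply: (@preimage_closed _ _ phi [set t | b <= t]) => [z _|].
  exact: cphi.
exact: closed_ge.
Qed.

Lemma continuous_pairC : continuous (fun p : R * R => p.1 +i* p.2).
Proof.
move=> [a b] A /nbhs_normcP[e e0 eA].
have e2 : 0 < e / 2 by lra.
exists (ball a (e/2), ball b (e/2)) => /=; first by split; exact: nbhsx_ballx.
move=> [x y] /= [hx hy]; apply: eA.
apply: le_lt_trans (normc_le_ReIm _) _ => /=.
move: hx hy; rewrite -!ball_normE /= (distrC a) (distrC b); lra.
Qed.

Lemma bounded_closed_compactC (K : set R[i]) (M : R) :
  closed K -> (forall z, K z -> normc z <= M) -> compact K.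
Proof.
move=> cK bK.
pose Q := (fun p : R * R => p.1 +i* p.2) @` (`[- M, M] `*` `[- M, M]).
have cQ : compact Q.
  apply: continuous_compact; last by apply: compact_setX; exact: segment_compact.
  apply: continuous_subspaceT; exact: continuous_pairC.
apply: (subclosed_compact cK cQ) => z Kz.
exists (complex.Re z, complex.Im z); last by case: (z).
have h1 := Re_le_normc z; have h2 := Im_le_normc z; have h3 := bK _ Kz.
by split; rewrite /= in_itv /= -ler_norml; lra.
Qed.

Lemma continuous_hornerC (p : {poly R[i]}) :
  continuous (horner p : R[i] -> R[i]).
Proof.
elim/poly_ind: p => [|p c IH] z.
  rewrite (_ : horner 0 = fun=> 0); last by apply/funext => w; rewrite horner0.
  exact: cst_continuous.
rewrite (_ : horner _ = (fun w : R[i] => p.[w] * w + c)); last first.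
  by apply/funext => w; rewrite hornerMXaddC.
have h : {for z, continuous (fun w : R[i] => p.[w] * w)}.
  by apply: continuousM; [exact: IH|exact: cvg_id].
have hc : (fun _ : R[i] => c) @ nbhs z --> c by exact: cst_continuous.
exact: (@cvgD _ _ _ (nbhs z) _ _ _ _ _ h hc).
Qed.

Lemma continuous_normc_horner (p : {poly R[i]}) :
  continuous (fun z : R[i] => normc p.[z]).
Proof.
move=> z; apply: (@continuous_comp _ _ _ (horner p) (@normc R)).
  exact: continuous_hornerC.
exact: continuous_normc.
Qed.

Lemma continuous_ratio (p q : {poly R[i]}) z : q.[z] != 0 ->
  {for z, continuous (fun w : R[i] => p.[w] / q.[w])}.
Proof.
move=> qz; apply: continuousM; first exact: continuous_hornerC.
by apply: continuousV => //; exact: continuous_hornerC.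
Qed.

Lemma compact_ratio_max (K : set R[i]) (p q : {poly R[i]}) :
  K !=set0 -> compact K -> (forall z, K z -> q.[z] != 0) ->
  exists2 z, K z & forall y, K y ->
     normc (p.[y] / q.[y]) <= normc (p.[z] / q.[z]).
Proof.
move=> K0 cK qK.
have [|z] := compact_EVT_max (f := fun z => normc (p.[z] / q.[z])) K0 cK.
  apply: continuous_in_subspaceT => z; rewrite inE => /qK qz.
  apply: (@continuous_comp _ _ _ (fun w => p.[w] / q.[w]) (@normc R)).
    exact: continuous_ratio.
  exact: continuous_normc.
rewrite inE => Kz h; exists z => // y Ky; apply: h; exact: mem_set.
Qed.

(** A Lebesgue number: near-coverings make the local margins uniform on [K]. *)
Lemma compact_open_margin (K O : set R[i]) : compact K -> open O -> K `<=` O ->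
  exists2 e : R, 0 < e & forall z z', K z -> normc (z' - z) < e -> O z'.
Proof.
move=> /compact_near_coveringP cK /open_normcP oO KO.
have := cK _ (0^'+ : set_system R) (fun e z => forall z', normc (z' - z) < e -> O z') _.
case.
  move=> z Kz; have [e e0 he] := oO z (KO _ Kz).
  have e2 : 0 < e / 2 by lra.
  exists ([set w | normc (w - z) < e / 2], [set t | t < e / 2]).
    split; first by apply/nbhs_normcP; exists (e / 2).
    exact: nbhs_right_lt.
  move=> [w t] /= [hw ht] z' hz'; apply: he.
  have := normcD (z' - w) (w - z); rewrite subrKA; lra.
move=> d /= d0 hd; exists (d / 2); first lra.
move=> z z' Kz; apply: (hd (d / 2)) => //=; last lra.
by rewrite sub0r normrN gtr0_norm; lra.
Qed.

End Modulus.

(** * Uniform approximation by rational functions *)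

Section RationalApproximation.
Variable R : realType.
Implicit Types (z x y : R[i]) (X : set R[i]) (f g : R[i] -> R[i]).

(** Membership in [R(X)] with the continuity clause dropped: it follows from
    uniform approximation, see [ratfunP]. *)
Definition rapprox X f := forall e : R, 0 < e ->
  exists p q : {poly R[i]}, (forall z, X z -> q.[z] != 0) /\
    (forall z, X z -> normc (f z - p.[z] / q.[z]) < e).

Lemma rapprox_continuous X f : rapprox X f -> {within X, continuous f}.
Proof.
move=> fX; apply/continuous_normcP => z Xz e e0.
have e3 : 0 < e / 3 by lra.
have [p [q [qX pqf]]] := fX _ e3.
have : nbhs (p.[z] / q.[z]) [set w | normc (w - p.[z] / q.[z]) < e / 3].
  by apply/nbhs_normcP; exists (e / 3).
move=> /(@continuous_ratio _ p q z (qX _ Xz))/nbhs_normcP[d d0 hd].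
exists d => // z' Xz' /hd /= h1.
have h2 := pqf _ Xz; have h3 := pqf _ Xz'.
have -> : f z' - f z = (f z' - p.[z'] / q.[z'])
   + ((p.[z'] / q.[z'] - p.[z] / q.[z]) - (f z - p.[z] / q.[z])) by ring.
have h4 := normcD (f z' - p.[z'] / q.[z'])
   ((p.[z'] / q.[z'] - p.[z] / q.[z]) - (f z - p.[z] / q.[z])).
have := normcD (p.[z'] / q.[z'] - p.[z] / q.[z]) (- (f z - p.[z] / q.[z])).
rewrite (normc_opp (f z - _)); lra.
Qed.

Lemma ratfunP X f : ratfun X f <-> rapprox X f.
Proof.
split.
- move=> [_ h] e /h[p [q [qX pqf]]]; exists p, q; split=> // z Xz.
  by have := pqf _ Xz; rewrite normC_normc ltcR.
- move=> h; split; first exact: rapprox_continuous.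
  move=> e /h[p [q [qX pqf]]]; exists p, q; split=> // z Xz.
  by rewrite normC_normc ltcR; exact: pqf.
Qed.

Lemma rapprox_subset X Y f : X `<=` Y -> rapprox Y f -> rapprox X f.
Proof.
move=> XY fY e /fY[p [q [qY pqf]]]; exists p, q.
by split=> z /XY; [exact: qY|exact: pqf].
Qed.

Lemma rapprox_cst X c : rapprox X (fun=> c).
Proof.
move=> e e0; exists c%:P, 1; split=> z _; first by rewrite hornerC oner_eq0.
by rewrite !hornerC divr1 subrr normc0.
Qed.

Lemma rapproxD X f g :
  rapprox X f -> rapprox X g -> rapprox X (fun z => f z + g z).
Proof.
move=> fX gX e e0; have e2 : 0 < e / 2 by lra.
have [p [q [qX pqf]]] := fX _ e2; have [p' [q' [q'X pqg]]] := gX _ e2.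
exists (p * q' + p' * q), (q * q'); split=> z Xz.
  by rewrite hornerM mulf_neq0 // ?qX ?q'X.
have h1 := pqf _ Xz; have h2 := pqg _ Xz.
have q0 := qX _ Xz; have q'0 := q'X _ Xz.
have -> : f z + g z - (p * q' + p' * q).[z] / (q * q').[z]
   = (f z - p.[z] / q.[z]) + (g z - p'.[z] / q'.[z]).
  by rewrite hornerD !hornerM; field; rewrite q0 q'0.
by have := normcD (f z - p.[z] / q.[z]) (g z - p'.[z] / q'.[z]); lra.
Qed.

Lemma rapproxZ X c f :
  rapprox X f -> rapprox X (fun z => c * f z).
Proof.
move=> fX e e0; have c1 : 0 < normc c + 1 by have := normc_ge0 c; lra.
have [|p [q [qX pqf]]] := fX (e / (normc c + 1)); first exact: divr_gt0.
exists (c *: p), q; split=> // z Xz.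
rewrite hornerZ -mulrA -mulrBr normcM.
have := pqf _ Xz; rewrite ltr_pdivlMr // => h1.
have := normc_ge0 (f z - p.[z] / q.[z]); lra.
Qed.

Lemma rapprox_lim X f :
  (forall e : R, 0 < e -> exists2 g, rapprox X g &
     forall z, X z -> normc (f z - g z) < e) -> rapprox X f.
Proof.
move=> h e e0; have e2 : 0 < e / 2 by lra.
have [g /(_ _ e2)[p [q [qX pqg]]] fg] := h _ e2.
exists p, q; split=> // z Xz.
have h1 := fg _ Xz; have h2 := pqg _ Xz.
by have := normcD (f z - g z) (g z - p.[z] / q.[z]); rewrite subrKA; lra.
Qed.

(** Values in the right half-plane stay at distance at least one from the pole
    [-1] of [w |-> 1 / (1 + w)], so the inverse of an approximant of [1 + f] is
    an approximant of the inverse. *)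
Lemma rapprox_inv1p X f : rapprox X f ->
  (forall z, X z -> 0 <= complex.Re (f z)) ->
  rapprox X (fun z => (1 + f z)^-1).
Proof.
move=> fX Ref e e0; pose d := Num.min (1 / 2) (e / 2).
have [d0 d1 de] : [/\ 0 < d, d <= 1 / 2 & d <= e / 2].
  by rewrite /d lt_min !ge_min !lexx orbT; split=> //; lra.
have [p [q [qX pqf]]] := fX _ d0.
have Re1r z : X z -> 1 / 2 <= complex.Re (1 + p.[z] / q.[z]).
  move=> Xz; have h1 := pqf _ Xz; have h2 := Ref _ Xz.
  have h3 := Re_le_normc (f z - p.[z] / q.[z]).
  have -> : complex.Re (1 + p.[z] / q.[z])
    = 1 + complex.Re (f z) - complex.Re (f z - p.[z] / q.[z]).
    by case: (f z) (_ / _) => [a b] [a' b'] /=; ring.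
  have := ler_norm (complex.Re (f z - p.[z] / q.[z])); lra.
have nz (w : R[i]) : 0 < complex.Re w -> w != 0.
  by move=> h; apply/eqP => w0; rewrite w0 ltxx in h.
have r0 z : X z -> 1 + p.[z] / q.[z] != 0.
  by move=> /Re1r h; apply: nz; lra.
have pqE z : X z -> (q + p).[z] = q.[z] * (1 + p.[z] / q.[z]).
  by move=> /qX q0; rewrite hornerD; field.
exists q, (q + p); split=> z Xz.
  by rewrite pqE // mulf_neq0 ?qX ?r0.
have q0 := qX _ Xz; have r0z := r0 _ Xz.
have f0 : 1 + f z != 0.
  apply: nz; have := Ref _ Xz.
  by case: (f z) => a b /=; lra.
have -> : (1 + f z)^-1 - q.[z] / (q + p).[z]
   = (- (f z - p.[z] / q.[z])) * (1 + f z)^-1 * (1 + p.[z] / q.[z])^-1.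
  rewrite pqE //; set r := p.[z] / q.[z] in r0z *.
  by field; rewrite f0 r0z q0.
rewrite !normcM normc_opp.
have h1 := pqf _ Xz.
have h2 : normc (1 + f z)^-1 <= 1.
  by apply: Re_ge1_normcV; have := Ref _ Xz; case: (f z) => a b /=; lra.
have h3 : normc (1 + p.[z] / q.[z])^-1 <= 2.
  rewrite normcV -[leRHS]invrK lef_pV2 ?posrE ?invr_gt0 ?normc_gt0 //.
  have := Re_le_normc (1 + p.[z] / q.[z]).
  have := ler_norm (complex.Re (1 + p.[z] / q.[z])); have := Re1r _ Xz; lra.
have h4 := normc_ge0 (f z - p.[z] / q.[z]).
have h5 := normc_ge0 (1 + f z)^-1; have h6 := normc_ge0 (1 + p.[z] / q.[z])^-1.
have h7 : normc (f z - p.[z] / q.[z]) * normc (1 + f z)^-1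
   <= normc (f z - p.[z] / q.[z]) by rewrite ler_piMr.
have : normc (f z - p.[z] / q.[z]) * normc (1 + f z)^-1 *
   normc (1 + p.[z] / q.[z])^-1 <= normc (f z - p.[z] / q.[z]) * 2.
  by apply: ler_pM => //; apply: mulr_ge0.
lra.
Qed.

End RationalApproximation.

(** * The maximum principle for rational functions *)

Section MaximumPrinciple.
Variable R : realType.
Implicit Types (z x y u c : R[i]) (X K : set R[i]) (f : R[i] -> R[i]) (p q : {poly R[i]}).

(** Near [z0] the function [p / q] is [A + B * (z - z0) ^+ m * (1 + o(1))] with
    [B != 0] unless [p = A *: q]; moving from [z0] in the direction where
    [B * (z - z0) ^+ m] is a positive multiple of [A] increases the modulus. *)
Lemma ratio_local_max p q z0 (e : R) : q.[z0] != 0 -> 0 < e ->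
  (forall z, normc (z - z0) < e ->
     normc (p.[z] / q.[z]) <= normc (p.[z0] / q.[z0])) ->
  p = (p.[z0] / q.[z0]) *: q.
Proof.
move=> q0 e0 maxz0; set A := p.[z0] / q.[z0] in maxz0 *.
apply/eqP; rewrite -subr_eq0; apply/negPn/negP => g0.
have [m [g1]] := multiplicity_XsubC (p - A *: q) z0.
rewrite g0 /= => g1z0 gE.
have m0 : (0 < m)%N.
  rewrite lt0n; apply/eqP => m0; move: g1z0; rewrite /root => /eqP; apply.
  have := congr1 (fun h => h.[z0]) gE.
  rewrite m0 expr0 mulr1 !hornerE => <-.
  by rewrite /A divfK // subrr.
have {}g1z0 : g1.[z0] != 0 by exact: g1z0.
(* If [A = 0] every direction increases the modulus, and [1] serves as target. *)
pose A' : R[i] := if A == 0 then 1 else A.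
have A'0 : 0 < normc A'.
  by rewrite normc_gt0 /A'; case: ifP => [_|/negbT //]; rewrite oner_eq0.
pose B := g1.[z0] / q.[z0].
have B0 : B != 0 by rewrite mulf_neq0 // invr_eq0.
have [om omE] : exists om : R[i], om ^+ m = A' / B.
  by exists (m.-root (A' / B))%C; rewrite rootCK.
have om1 : 0 < 1 + normc om ^+ m by have := exprn_ge0 m (normc_ge0 om); lra.
pose eta := normc A' / (1 + normc om ^+ m).
have eta0 : 0 < eta by rewrite divr_gt0.
have : nbhs B [set w | normc (w - B) < eta] by apply/nbhs_normcP; exists eta.
move=> /(@continuous_ratio _ g1 q z0 q0)/nbhs_normcP[d d0 hd].
have : nbhs (q.[z0]) [set w : R[i] | w != 0].
  apply/nbhs_normcP; exists (normc q.[z0]); first by rewrite normc_gt0.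
  move=> w hw /=; apply/eqP => w0; move: hw.
  by rewrite w0 sub0r normc_opp ltxx.
move=> /(@continuous_hornerC _ q z0)/nbhs_normcP[d' d'0 hd'].
pose t := Num.min e (Num.min d d') / (2 * (1 + normc om)).
have om2 : 0 < 1 + normc om by have := normc_ge0 om; lra.
have md0 : 0 < Num.min e (Num.min d d') by rewrite !lt_min e0 d0.
have t0 : 0 < t by rewrite divr_gt0 // mulr_gt0.
pose z := z0 + t%:C * om.
have zz0 : normc (z - z0) < Num.min e (Num.min d d').
  rewrite /z addrC addKr normcM normc_real gtr0_norm //.
  rewrite /t mulrAC ltr_pdivrMr ?mulr_gt0 // ltr_pM2l //.
  by have := normc_ge0 om; lra.
move: zz0; rewrite !lt_min => /andP[ze /andP[zd zd']].
have qz : q.[z] != 0 := hd' z zd'.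
have hB : normc (g1.[z] / q.[z] - B) < eta := hd z zd.
have rE : p.[z] / q.[z] =
    (A + (t ^+ m)%:C * A') + (t ^+ m)%:C * om ^+ m * (g1.[z] / q.[z] - B).
  have := congr1 (fun h => h.[z]) gE.
  rewrite !hornerE /= => /eqP; rewrite subr_eq => /eqP ->.
  have -> : z - z0 = t%:C * om by rewrite /z addrC addKr.
  have omB : om ^+ m * B = A' by rewrite omE divfK.
  rewrite -omB exprMn rmorphXn /=; set tt := _ ^+ m; set oo := om ^+ m.
  by field.
have tm0 : 0 < t ^+ m by rewrite exprn_gt0.
have AA' : normc (A + (t ^+ m)%:C * A') = normc A + t ^+ m * normc A'.
  rewrite /A'; case: eqP => [->|_].
    by rewrite normc0 mulr1 !add0r normc1 mulr1 normc_real gtr0_norm.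
  have -> : A + (t ^+ m)%:C * A = (1 + t ^+ m)%:C * A.
    by rewrite rmorphD /= mulrDl mul1r.
  by rewrite normcM normc_real gtr0_norm; [ring|lra].
have h1 := normcD (p.[z] / q.[z]) (- ((t ^+ m)%:C * om ^+ m * (g1.[z] / q.[z] - B))).
move: h1; rewrite {1}rE addrK AA' normc_opp !normcM normc_real (gtr0_norm tm0) normcX.
have h2 : normc om ^+ m * normc (g1.[z] / q.[z] - B) < normc A'.
  apply: le_lt_trans (_ : normc om ^+ m * eta < _).
    by apply: ler_wpM2l; [exact: exprn_ge0 (normc_ge0 _)|exact: ltW].
  rewrite /eta mulrA ltr_pdivrMr // mulrC ltr_pM2l //; lra.
have h3 := maxz0 z ze.
rewrite -mulrA -(normcM p.[z]) -(normcM p.[z0]) -/A => h4.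
have : t ^+ m * (normc om ^+ m * normc (g1.[z] / q.[z] - B)) < t ^+ m * normc A'.
  by rewrite ltr_pM2l.

lra.
Qed.

(** An interior maximum makes [p / q] constant on [K], hence equal in modulus to
    its value at a point of [K] farthest from the origin, which is a boundary
    point. *)
Lemma maximum_principle K p q (M : R) : compact K ->
  (forall z, K z -> q.[z] != 0) ->
  (forall z, K z -> ~ K° z -> normc (p.[z] / q.[z]) <= M) ->
  forall z, K z -> normc (p.[z] / q.[z]) <= M.
Proof.
move=> cK qK bM z Kz; have K0 : K !=set0 by exists z.
have locmax p' q' z0 : (forall z, K z -> q'.[z] != 0) -> K z0 ->
    (forall y, K y -> normc (p'.[y] / q'.[y]) <= normc (p'.[z0] / q'.[z0])) ->
    K° z0 -> p' = (p'.[z0] / q'.[z0]) *: q'.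
  move=> q'K Kz0 max0 /nbhs_normcP[e e0 he].
  by apply: (@ratio_local_max _ _ _ e) => [||y /he /max0 //]; first exact: q'K.
have [z0 Kz0 max0] := compact_ratio_max p K0 cK qK.
apply: le_trans (max0 _ Kz) _.
have [iz0|niz0] := pselect (K° z0); last exact: bM.
have one_neq0 w : K w -> (1 : {poly R[i]}).[w] != 0.
  by rewrite hornerC oner_eq0.
(* [z1] is farthest from [0]; it is not interior by the local principle for ['X]. *)
have [z1 Kz1 max1] := compact_ratio_max 'X K0 cK one_neq0.
have niz1 : ~ K° z1.
  move=> /(locmax 'X 1 z1 one_neq0 Kz1 max1) /(congr1 (size : {poly R[i]} -> nat)).
  rewrite size_polyX => h; have := size_scale_leq ('X.[z1] / 1.[z1]) (1 : {poly R[i]}).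
  by rewrite -h size_poly1.
have pE := locmax p q z0 qK Kz0 max0 iz0.
have -> : normc (p.[z0] / q.[z0]) = normc (p.[z1] / q.[z1]).
  have -> : p.[z1] = p.[z0] / q.[z0] * q.[z1] by rewrite {1}pE hornerZ.
  by move: (p.[z0] / _) (q.[z1]) (qK _ Kz1) => A B B0; rewrite mulfK.
exact: bM.
Qed.

Lemma rapprox_bounded X K f : rapprox X f -> compact K -> K `<=` X ->
  exists2 M : R, 0 < M & forall z, K z -> normc (f z) <= M.
Proof.
move=> fX cK KX; have [p [q [qX pqf]]] := fX 1 ltr01.
have [K0|] := pselect (K !=set0); last first.
  by move=> nK; exists 1 => // z Kz; exfalso; apply: nK; exists z.
have qK z : K z -> q.[z] != 0 by move=> /KX/qX.
have [z0 Kz0 h] := compact_ratio_max p K0 cK qK.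
exists (normc (p.[z0] / q.[z0]) + 1).
  by have := normc_ge0 (p.[z0] / q.[z0]); lra.
move=> z Kz; have h1 := pqf z (KX _ Kz); have h2 := h z Kz.
by have := normcD (f z - p.[z] / q.[z]) (p.[z] / q.[z]); rewrite subrK; lra.
Qed.

Lemma expr_lt_eventually (x e : R) : 0 <= x < 1 -> 0 < e ->
  exists m, x ^+ m < e.
Proof.
move=> /andP[x0 x1] e0.
have : (x ^+ n) @[n --> \oo] --> (0 : R) by apply: cvg_expr; rewrite ger0_norm.
move=> /cvgr0Pnorm_lt /(_ _ e0)[m _ hm]; exists m.
by have := hm m (leqnn m) => /=; rewrite ger0_norm // exprn_ge0.
Qed.

End MaximumPrinciple.

(** * Uniqueness for limits of rational functions *)

Section Uniqueness.
Variable R : realType.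
Implicit Types (z x y u c : R[i]) (X K : set R[i]) (f : R[i] -> R[i]) (p q : {poly R[i]}).

(** Schwarz's argument: the maximum principle on the annulus, applied to
    [f z / (z - u) ^+ m], gives [normc (f z) <= M * (normc (z - u) / rho) ^+ m]
    for all [m], since [f] vanishes on the inner circle. *)
Lemma zero_on_disc X f u (eta rho : R) : rapprox X f -> 0 < eta ->
  (forall z, normc (z - u) <= rho -> X z) ->
  (forall z, normc (z - u) < eta -> f z = 0) ->
  forall z, normc (z - u) < rho -> f z = 0.
Proof.
move=> fX eta0 discX f0 z zrho.
have [?|etaz] := ltP (normc (z - u)) eta; first exact: f0.
pose K := [set w | eta / 2 <= normc (w - u) <= rho].
have cK : compact K.
  apply: (@bounded_closed_compactC _ _ (rho + normc u)); last first.
    by move=> w /andP[_ h]; have := normcD (w - u) u; rewrite subrK; lra.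
  rewrite (_ : K = [set w | eta / 2 <= normc (w - u)] `&`
                   [set w | normc (w - u) <= rho]); last first.
    by apply/seteqP; split=> w /andP.
  by apply: closedI; [apply: closed_ge_continuous|apply: closed_le_continuous];
    exact: continuous_normcB.
have KX : K `<=` X by move=> w /andP[_ /discX].
have [M M0 fM] := rapprox_bounded fX cK KX.
have rho0 : 0 < rho by lra.
have sr : 0 <= normc (z - u) / rho < 1.
  by rewrite divr_ge0 ?normc_ge0 ?ltW //= ltr_pdivrMr ?mul1r.
apply/eqP; rewrite -normc_eq0; apply/negPn/negP => fz0.
have {}fz0 : 0 < normc (f z) by rewrite lt_def fz0 normc_ge0.
have [m hm] : exists m, (normc (z - u) / rho) ^+ m < normc (f z) / (2 * (M + 1)).
  by apply: expr_lt_eventually => //; rewrite divr_gt0 //; lra.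
have em0 : 0 < (eta / 2) ^+ m by rewrite exprn_gt0 //; lra.
have rm0 : 0 < rho ^+ m by rewrite exprn_gt0.
pose e := Num.min (Num.min 1 (normc (f z) / 2))
  ((M + 1) / rho ^+ m * (eta / 2) ^+ m).
have [e0 e1 ez em] : [/\ 0 < e, e <= 1, e <= normc (f z) / 2 &
   e <= (M + 1) / rho ^+ m * (eta / 2) ^+ m].
  rewrite /e !lt_min !ge_min !lexx !orbT /=; split => //.
  by rewrite ltr01 divr_gt0 //= mulr_gt0 // divr_gt0 //; lra.
have [p [q [qX pqf]]] := fX _ e0.
have q'K w : K w -> (q * ('X - u%:P) ^+ m).[w] != 0.
  move=> Kw; rewrite !hornerE /= mulf_neq0 ?qX //; first exact: KX.
  by rewrite expf_neq0 // -normc_gt0; move/andP: Kw => [? _]; lra.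
have rE w : normc (p.[w] / (q * ('X - u%:P) ^+ m).[w]) =
   normc (p.[w] / q.[w]) / normc (w - u) ^+ m.
  by rewrite !hornerE /= invfM mulrA !normcM !normcV normcX.
have rM w : K w -> normc (p.[w] / q.[w]) <= M + 1.
  move=> Kw; have h1 := fM _ Kw; have h2 := pqf _ (KX _ Kw).
  have := normcD (f w) (- (f w - p.[w] / q.[w])).
  by rewrite normc_opp opprB addrC subrK; lra.
have bd w : K w -> ~ K° w ->
    normc (p.[w] / (q * ('X - u%:P) ^+ m).[w]) <= (M + 1) / rho ^+ m.
  move=> Kw niw; rewrite rE; move/andP: (Kw) => [w1 w2].
  have [wr|wr] := eqVneq (normc (w - u)) rho.
    by rewrite wr ler_pM2r ?invr_gt0 //; exact: rM.
  have [we|we] := eqVneq (normc (w - u)) (eta / 2).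
    rewrite we ler_pdivrMr //; apply: le_trans em.
    have := pqf _ (KX _ Kw); rewrite f0; last by lra.
    by rewrite sub0r normc_opp; lra.
  case: niw; apply/nbhs_normcP.
  exists (Num.min (rho - normc (w - u)) (normc (w - u) - eta / 2)).
    by rewrite lt_min !subr_gt0 !lt_def [rho == _]eq_sym wr we w1 w2.
  move=> w'; rewrite lt_min => /andP[h1 h2] /=.
  have := normcD (w' - w) (w - u); have := normcD (w - w') (w' - u).
  rewrite !subrKA (normc_distC w w') => h3 h4.
  by apply/andP; split; clear - h1 h2 h3 h4 w1 w2; lra.
have Kz : K z by apply/andP; split; clear - etaz zrho eta0; lra.
have := maximum_principle cK q'K bd Kz; rewrite rE.
have nz0 : 0 < normc (z - u) ^+ m by rewrite exprn_gt0 //; lra.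
rewrite ler_pdivrMr // mulrAC -mulrA -expr_div_n => h.
have h1 := pqf _ (KX _ Kz).
have h2 := normcD (f z - p.[z] / q.[z]) (p.[z] / q.[z]); rewrite subrK in h2.
have : (M + 1) * (normc (z - u) / rho) ^+ m < (M + 1) * (normc (f z) / (2 * (M + 1))).
  by rewrite ltr_pM2l //; lra.
have -> : (M + 1) * (normc (f z) / (2 * (M + 1))) = normc (f z) / 2.
  by field; rewrite gt_eqF //; lra.
lra.
Qed.

(** Multiplying the four rotates of [f] about the centre of a square gives a
    function that vanishes on all four sides as soon as [f] vanishes on one; its
    value at the centre is [f c ^+ 4]. *)
Lemma zero_at_square_center X f c (d : R) : rapprox X f -> 0 < d ->
  (forall z, `|complex.Re (z - c)| <= d -> `|complex.Im (z - c)| <= d -> X z) ->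
  (forall z, complex.Re (z - c) = d -> `|complex.Im (z - c)| <= d -> f z = 0) ->
  f c = 0.
Proof.
move=> fX d0 QX f0.
pose K := [set w : R[i] | `|complex.Re (w - c)| <= d /\ `|complex.Im (w - c)| <= d].
have cK : compact K.
  apply: (@bounded_closed_compactC _ _ (d + d + normc c)); last first.
    move=> w [h1 h2]; have := normcD (w - c) c; rewrite subrK.
    by have := normc_le_ReIm (w - c); lra.
  have cn (phi : R[i] -> R) : continuous phi ->
      continuous (fun w : R[i] => `|phi (w - c)|).
    move=> cphi w; apply: (@continuous_comp _ _ _ (fun w => phi (w - c)) Num.norm).
      apply: (@continuous_comp _ _ _ (fun w => w - c) phi); last exact: cphi.
      move=> A /nbhs_normcP[e e0 eA]; apply/nbhs_normcP; exists e => // z' hz.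
      by apply: eA; rewrite opprB addrA subrK.
    exact: norm_continuous.
  by apply: closedI; apply: closed_le_continuous; apply: cn;
    [exact: continuous_ReC|exact: continuous_ImC].
have KX : K `<=` X by move=> w [h1 h2]; exact: QX.
have [M M0 fM] := rapprox_bounded fX cK KX.
pose rot (k : nat) (z : R[i]) := c + 'i%C ^+ k * (z - c).
have rotS k z : rot k.+1 z - c = 'i%C * (rot k z - c).
  by rewrite /rot exprS; ring.
have reim z : complex.Re ('i%C * z) = - complex.Im z /\
    complex.Im ('i%C * z) = complex.Re z.
  by case: z => a b /=; split; ring.
have rotK k z : K z -> K (rot k z).
  move=> Kz; elim: k => [|k [h1 h2]].
    by rewrite /rot expr0 mul1r addrC subrK.
  have [r1 r2] := reim (rot k z - c).
  by rewrite /K /= rotS r1 r2 normrN.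
apply/eqP; rewrite -normc_eq0; apply/negPn/negP => fc0.
have {}fc0 : 0 < normc (f c) by rewrite lt_def fc0 normc_ge0.
pose B := M + 1; have B0 : 0 < B ^+ 3 by rewrite exprn_gt0 // /B; lra.
have B1 : 0 < B by rewrite /B; lra.
pose e := Num.min (Num.min 1 (normc (f c) / 2)) ((normc (f c) / 2) ^+ 4 / B ^+ 3).
have [e0 e1 ec eB] : [/\ 0 < e, e <= 1, e <= normc (f c) / 2 &
   e <= (normc (f c) / 2) ^+ 4 / B ^+ 3].
  rewrite /e !lt_min !ge_min !lexx !orbT /=; split => //.
  by rewrite ltr01 divr_gt0 //= divr_gt0 // exprn_gt0 // divr_gt0.
have [p [q [qX pqf]]] := fX _ e0.
have rM w : K w -> normc (p.[w] / q.[w]) <= B.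
  move=> Kw; have h1 := fM _ Kw; have h2 := pqf _ (KX _ Kw).
  have := normcD (f w) (- (f w - p.[w] / q.[w])).
  by rewrite normc_opp opprB addrC subrK /B; lra.
pose rotp (k : nat) : {poly R[i]} := c%:P + ('i%C ^+ k)%:P * ('X - c%:P).
have rotpE k z : (rotp k).[z] = rot k z by rewrite /rotp !hornerE.
pose P := (p \Po rotp 0%N) * (p \Po rotp 1%N) * (p \Po rotp 2%N) * (p \Po rotp 3%N).
pose Q := (q \Po rotp 0%N) * (q \Po rotp 1%N) * (q \Po rotp 2%N) * (q \Po rotp 3%N).
pose r z := normc (p.[z] / q.[z]).
have compE (g : {poly R[i]}) k z : (g \Po rotp k).[z] = g.[rot k z].
  by rewrite horner_comp rotpE.
have PE z : P.[z] = p.[rot 0%N z] * p.[rot 1%N z] * p.[rot 2%N z] * p.[rot 3%N z].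
  by rewrite /P 3!hornerM !compE.
have QE z : Q.[z] = q.[rot 0%N z] * q.[rot 1%N z] * q.[rot 2%N z] * q.[rot 3%N z].
  by rewrite /Q 3!hornerM !compE.
have PQE z : normc (P.[z] / Q.[z]) =
    r (rot 0%N z) * r (rot 1%N z) * r (rot 2%N z) * r (rot 3%N z).
  rewrite PE QE /r.
  move: p.[rot 0%N z] p.[rot 1%N z] p.[rot 2%N z] p.[rot 3%N z].
  move: q.[rot 0%N z] q.[rot 1%N z] q.[rot 2%N z] q.[rot 3%N z].
  move=> b0 b1 b2 b3 a0 a1 a2 a3; rewrite -!normcM !invfM; congr normc.
  by ring.
have QK z : K z -> Q.[z] != 0.
  have qr k : K z -> q.[rot k z] != 0 by move=> Kz; apply: qX; exact: KX (rotK k z Kz).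
  by move=> Kz; rewrite QE !(mulf_neq0, qr).
have r0 z : 0 <= r z by exact: normc_ge0.
have side k z : K z -> complex.Re (rot k z - c) = d -> r (rot k z) <= e.
  move=> Kz h; have [h1 h2] := rotK k z Kz.
  have := pqf _ (KX _ (rotK k z Kz)); rewrite f0 // sub0r normc_opp.
  exact: ltW.
have bd z : K z -> ~ K° z -> normc (P.[z] / Q.[z]) <= e * B ^+ 3.
  move=> Kz niz; rewrite PQE.
  have rB k : r (rot k z) <= B by apply: rM; exact: rotK.
  have BB a b a' b' : 0 <= a -> 0 <= b -> a <= a' -> b <= b' -> a * b <= a' * b'.
    by move=> *; apply: ler_pM.
  have [h1 h2] := Kz.
  have rot0 : rot 0%N z = z by rewrite /rot expr0 mul1r addrC subrK.
  have r1 : complex.Re (rot 1%N z - c) = - complex.Im (z - c) /\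
      complex.Im (rot 1%N z - c) = complex.Re (z - c).
    by rewrite rotS rot0; exact: reim.
  have r2 : complex.Re (rot 2%N z - c) = - complex.Re (z - c) /\
      complex.Im (rot 2%N z - c) = - complex.Im (z - c).
    by rewrite rotS; have [-> ->] := reim (rot 1%N z - c); case: r1 => -> ->.
  have r3 : complex.Re (rot 3%N z - c) = complex.Im (z - c).
    by rewrite rotS; have [-> _] := reim (rot 2%N z - c); case: r2 => _ ->; ring.
  have [Re_d|Re_d] := eqVneq `|complex.Re (z - c)| d.
    move: Re_d; case: (ger0P (complex.Re (z - c))) => _ Re_d.
      have s := side 0%N z Kz; rewrite rot0 in s.
      have {}s := s Re_d.
      rewrite (_ : e * B ^+ 3 = e * B * B * B); last by ring.
      by rewrite !BB ?mulr_ge0 // rot0.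
    have s := side 2%N z Kz; rewrite r2.1 in s; have {}s := s Re_d.
    rewrite (_ : e * B ^+ 3 = B * B * e * B); last by ring.
    by rewrite !BB ?mulr_ge0.
  have [Im_d|Im_d] := eqVneq `|complex.Im (z - c)| d.
    move: Im_d; case: (ger0P (complex.Im (z - c))) => _ Im_d.
      have s := side 3%N z Kz; rewrite r3 in s; have {}s := s Im_d.
      rewrite (_ : e * B ^+ 3 = B * B * B * e); last by ring.
      by rewrite !BB ?mulr_ge0.
    have s := side 1%N z Kz; rewrite r1.1 in s; have {}s := s Im_d.
    rewrite (_ : e * B ^+ 3 = B * e * B * B); last by ring.
    by rewrite !BB ?mulr_ge0.
  case: niz; apply/nbhs_normcP.
  exists (Num.min (d - `|complex.Re (z - c)|) (d - `|complex.Im (z - c)|)).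
    by rewrite lt_min !subr_gt0 !lt_def ![d == _]eq_sym Re_d Im_d h1 h2.
  move=> w; rewrite lt_min => /andP[w1 w2].
  have := Re_le_normc (w - z); have := Im_le_normc (w - z).
  have := ler_normD (complex.Re (w - z)) (complex.Re (z - c)).
  have := ler_normD (complex.Im (w - z)) (complex.Im (z - c)).
  rewrite (_ : complex.Re (w - z) + _ = complex.Re (w - c)); last first.
    by case: (w) (z) (c) => [? ?] [? ?] [? ?] /=; ring.
  rewrite (_ : complex.Im (w - z) + _ = complex.Im (w - c)); last first.
    by case: (w) (z) (c) => [? ?] [? ?] [? ?] /=; ring.
  by move=> *; split; lra.
have Kc : K c by split; rewrite subrr normr0 ltW.
have := maximum_principle cK QK bd Kc; rewrite PQE.
have rotc k : rot k c = c by rewrite /rot subrr mulr0 addr0.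
rewrite !rotc.
have rc : normc (f c) / 2 < r c.
  have := pqf _ (KX _ Kc).
  have := normcD (f c - p.[c] / q.[c]) (p.[c] / q.[c]); rewrite subrK /r; lra.
have : e * B ^+ 3 <= (normc (f c) / 2) ^+ 4 by rewrite -ler_pdivlMr.
have : (normc (f c) / 2) ^+ 4 < r c ^+ 4.
  by rewrite ltrXn2r // ?nnegrE ?divr_ge0 // ltW.
rewrite (_ : r c ^+ 4 = r c * r c * r c * r c); last by ring.
lra.
Qed.

End Uniqueness.

(** * Connectedness and barycentric coordinates *)

Section Connectedness.
Variable R : realType.
Implicit Types (z x y : R[i]) (D : set R[i]) (P : R[i] -> Prop).

(** Connectedness phrased for predicates: a locally constant predicate on the
    plane is easier to extend across a slit than a pair of separating sets. *)
Definition locally_constant D P := forall z, D z ->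
  exists2 e : R, 0 < e & forall z', D z' -> normc (z' - z) < e -> (P z' <-> P z).

Definition connectedC D := forall P, locally_constant D P ->
  forall x y, D x -> D y -> P x -> P y.

Definition convexC D := forall x y (t : R), D x -> D y -> 0 <= t <= 1 ->
  D (x + t%:C * (y - x)).

Lemma locally_constantN D P :
  locally_constant D P -> locally_constant D (fun z => ~ P z).
Proof.
move=> h z Dz; have [e e0 he] := h z Dz; exists e => // z' Dz' hz.
by rewrite he.
Qed.

Lemma locally_constant_subset D D' P : D `<=` D' ->
  locally_constant D' P -> locally_constant D P.
Proof.
move=> DD' h z Dz; have [e e0 he] := h z (DD' _ Dz); exists e => // z' Dz'.
by apply: he; exact: DD'.
Qed.

Lemma connectedC_setU D D' z : connectedC D -> connectedC D' -> D z -> D' z ->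
  connectedC (D `|` D').
Proof.
move=> cD cD' Dz D'z P lP.
have lD : locally_constant D P by apply: locally_constant_subset lP => ?; left.
have lD' : locally_constant D' P by apply: locally_constant_subset lP => ?; right.
have toz x : (D `|` D') x -> P x -> P z.
  by move=> [Dx|D'x] Px; [exact: cD Px|exact: cD' Px].
have ofz x : (D `|` D') x -> P z -> P x.
  by move=> [Dx|D'x] Pz; [exact: cD Pz|exact: cD' Pz].
by move=> x y Dx Dy /(toz _ Dx)/(ofz _ Dy).
Qed.

Lemma convexC_connected D : convexC D -> connectedC D.
Proof.
move=> cD P lP x y Dx Dy Px.
pose gam (t : R) := x + t%:C * (y - x).
have gamD (t : R) : `[0, 1]%classic t -> D (gam t).
  by rewrite /= in_itv /=; exact: cD.
have near_gam (Q : R[i] -> Prop) (t : R) : locally_constant D Q ->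
    `[0, 1]%classic t -> Q (gam t) ->
    nbhs t [set s | `[0, 1]%classic s -> Q (gam s)].
  move=> lQ t01 Qt; have [e e0 he] := lQ _ (gamD _ t01).
  have n0 : 0 < normc (y - x) + 1 by have := normc_ge0 (y - x); lra.
  apply/nbhs_ballP; exists (e / (normc (y - x) + 1)) => /=; first exact: divr_gt0.
  move=> s; rewrite -ball_normE /= distrC ltr_pdivlMr // => hs s01.
  apply/he => //; first exact: gamD.
  have -> : gam s - gam t = (s - t)%:C * (y - x).
    by rewrite /gam rmorphB /=; ring.
  rewrite normcM normc_real; apply: le_lt_trans hs.
  by apply: ler_wpM2l => //; lra.
pose B := `[0, 1]%classic `&` [set t : R | P (gam t)].
have BE : B = `[0, 1]%classic.
  apply: (@segment_connected R 0 1).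
  - by exists 0; split; rewrite /= ?in_itv /= ?lexx ?ler01 // /gam mul0r addr0.
  - exists ([set s : R | `[0, 1]%classic s -> P (gam s)]°).
      exact: open_interior.
    apply/seteqP; split=> t [t01 h]; split => //; first exact: near_gam.
    by have /nbhs_singleton := h; exact.
  - exists (~` [set s : R | `[0, 1]%classic s -> ~ P (gam s)]°).
      by apply: open_closedC; exact: open_interior.
    apply/seteqP; split=> t [t01 h]; split => //.
      by move=> /nbhs_singleton; apply.
    apply: contrapT => nP; apply: h; apply: (near_gam (fun w => ~ P w)) => //.
    exact: locally_constantN.
have : B 1 by rewrite BE /= in_itv /= lexx ler01.
by case=> _; rewrite /= /gam mul1r addrC subrK.
Qed.

End Connectedness.

Section Barycentric.
Variable R : realType.
Implicit Types (z x y p q r : R[i]).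

Lemma gt_segment (b s t u : R) : b < s -> b < t -> 0 <= u <= 1 ->
  b < s + u * (t - s).
Proof. by move=> bs bt /andP[u0 u1]; case: (lerP s t) => st; nra. Qed.

Lemma lt_segment (b s t u : R) : s < b -> t < b -> 0 <= u <= 1 ->
  s + u * (t - s) < b.
Proof. by move=> bs bt /andP[u0 u1]; case: (lerP s t) => st; nra. Qed.

Lemma comb_lt (u v t x y s b : R) : 0 <= u -> 0 <= v -> 0 <= t -> u + v + t = 1 ->
  x < b -> y < b -> s < b -> u * x + v * y + t * s < b.
Proof.
move=> u0 v0 t0 uvt xb yb sb.
pose m := Num.max x (Num.max y s).
have mb : m < b by rewrite !gt_max xb yb.
have [xm ym sm] : [/\ x <= m, y <= m & s <= m].
  by rewrite /m !le_max !lexx !orbT.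
have h1 := ler_wpM2l u0 xm; have h2 := ler_wpM2l v0 ym; have h3 := ler_wpM2l t0 sm.
have : u * m + v * m + t * m = m by rewrite -!mulrDl uvt mul1r.
lra.
Qed.

(** The oriented area of the parallelogram spanned by [x] and [y]. *)
Definition cross x y : R :=
  complex.Re x * complex.Im y - complex.Im x * complex.Re y.

(** The barycentric coordinate of [z] at the vertex [p]. *)
Definition bary p q r z : R := cross (q - z) (r - z) / cross (q - p) (r - p).

Lemma cross_cycle p q r : cross (r - q) (p - q) = cross (q - p) (r - p).
Proof. by case: p q r => [? ?] [? ?] [? ?]; rewrite /cross /=; ring. Qed.

Lemma bary_sum p q r z : cross (q - p) (r - p) != 0 ->
  bary p q r z + bary q r p z + bary r p q z = 1.
Proof.
move=> h; rewrite /bary (cross_cycle q r p) !(cross_cycle p q r).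
rewrite -!mulrDl -[RHS](divff h); congr (_ / _).
by case: p q r z {h} => [? ?] [? ?] [? ?] [? ?]; rewrite /cross /=; ring.
Qed.

Lemma baryE p q r z : cross (q - p) (r - p) != 0 ->
  z = (bary p q r z)%:C * p + (bary q r p z)%:C * q + (bary r p q z)%:C * r.
Proof.
move=> h; rewrite /bary (cross_cycle q r p) !(cross_cycle p q r).
move: h; case: p q r z => [p1 p2] [q1 q2] [r1 r2] [z1 z2]; rewrite /cross /= => h.
by apply/eqP; rewrite eq_complex /=; apply/andP; split; apply/eqP; field.
Qed.

Lemma bary_comb p q r (u v w : R) : cross (q - p) (r - p) != 0 -> u + v + w = 1 ->
  let z := u%:C * p + v%:C * q + w%:C * r in
  [/\ bary p q r z = u, bary q r p z = v & bary r p q z = w].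
Proof.
move=> h uvw z; have -> : z = (1 - v - w)%:C * p + v%:C * q + w%:C * r.
  by congr (_%:C * p + _ + _); lra.
have uE : u = 1 - v - w by lra.
rewrite uE {z uE uvw}.
move: h; rewrite /bary (cross_cycle q r p) !(cross_cycle p q r) /cross.
case: p q r => [p1 p2] [q1 q2] [r1 r2] /= h.
by split; field.
Qed.

Lemma bary_shift p q r z x y (t : R) :
  bary p q r (z + t%:C * (y - x)) =
  bary p q r z + t * (bary p q r y - bary p q r x).
Proof.
rewrite /bary; move: (_^-1) => d; rewrite /cross.
by case: q r x y z => [? ?] [? ?] [? ?] [? ?] [? ?] /=; ring.
Qed.

Lemma bary_vertex p q r : cross (q - p) (r - p) != 0 ->
  [/\ bary p q r p = 1, bary p q r q = 0 & bary p q r r = 0].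
Proof.
move=> h; split; rewrite /bary; first by rewrite divff.
- by rewrite subrr /cross /= !mul0r subrr mul0r.
- by rewrite subrr /cross /= !mulr0 subrr mul0r.
Qed.

Lemma continuous_affineC (a b c : R) :
  continuous (fun z : R[i] => a * complex.Re z + b * complex.Im z + c).
Proof.
move=> z; apply: (@cvgD _ _ _ (nbhs z)); last exact: cvg_cst.
by apply: (@cvgD _ _ _ (nbhs z)); apply: (@cvgM _ _ (nbhs z));
  solve [exact: cvg_cst|exact: continuous_ReC|exact: continuous_ImC].
Qed.

Lemma continuous_bary p q r : continuous (bary p q r).
Proof.
rewrite (_ : bary p q r = fun z =>
   (complex.Im q - complex.Im r) / cross (q - p) (r - p) * complex.Re z
   + (complex.Re r - complex.Re q) / cross (q - p) (r - p) * complex.Im z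
   + cross q r / cross (q - p) (r - p)); first exact: continuous_affineC.
apply/funext => z; rewrite /bary; move: (_^-1) => d; rewrite /cross.
by case: q r z => [? ?] [? ?] [? ?] /=; ring.
Qed.

Section NondegenerateTriangle.
Variables p q r : R[i].
Hypothesis pqr : cross (q - p) (r - p) != 0.

Lemma triangleP z : triangle p q r z <->
  [/\ 0 <= bary p q r z, 0 <= bary q r p z & 0 <= bary r p q z].
Proof.
split.
- by move=> [u [v [w [u0 v0 w0 uvw ->]]]]; have [-> -> ->] := bary_comb pqr uvw.
- move=> [u0 v0 w0]; exists (bary p q r z), (bary q r p z), (bary r p q z).
  by split=> //; [exact: bary_sum|exact: baryE].
Qed.

Lemma triangle_interior z : 0 < bary p q r z -> 0 < bary q r p z ->
  0 < bary r p q z -> (triangle p q r)° z.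
Proof.
move=> u0 v0 w0.
have pos p' q' r' : 0 < bary p' q' r' z -> nbhs z [set x | 0 < bary p' q' r' x].
  by move=> h; apply: (@continuous_bary p' q' r' z [set t | 0 < t]); exact: lt_nbhsr.
apply: filterS3 (pos _ _ _ u0) (pos _ _ _ v0) (pos _ _ _ w0) => x ux vx wx.
by apply/triangleP; split; exact: ltW.
Qed.

Lemma closed_triangle : closed (triangle p q r).
Proof.
rewrite (_ : triangle p q r = [set z | 0 <= bary p q r z] `&`
   ([set z | 0 <= bary q r p z] `&` [set z | 0 <= bary r p q z])).
  by do 2?[apply: closedI]; apply: closed_ge_continuous; exact: continuous_bary.
by apply/seteqP; split=> z /=; rewrite triangleP => -[? []//].
Qed.

Lemma triangle_normc z : triangle p q r z -> normc z <= normc p + normc q + normc r.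
Proof.
move=> [u [v [w [u0 v0 w0 uvw ->]]]].
have := normcD (u%:C * p + v%:C * q) (w%:C * r).
have := normcD (u%:C * p) (v%:C * q).
rewrite !normcM !normc_real !ger0_norm //.
have h (a b : R) : 0 <= a -> a <= 1 -> 0 <= b -> a * b <= b by move=> *; rewrite ler_piMl.
have := h u _ u0 _ (normc_ge0 p); have := h v _ v0 _ (normc_ge0 q).
have := h w _ w0 _ (normc_ge0 r); lra.
Qed.

Lemma compact_triangle : compact (triangle p q r).
Proof. exact: bounded_closed_compactC closed_triangle triangle_normc. Qed.

(** An open neighbourhood of the two sides through [r], outside the triangle and
    on the inner side of the line [p q]. *)
Definition collar (e : R) : set R[i] :=
  [set z | [/\ - e < bary p q r z, - e < bary q r p z, 0 < bary r p q z &
               bary p q r z < 0 \/ bary q r p z < 0]].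

Lemma collar_connected (e : R) : 0 < e -> connectedC (collar e).
Proof.
move=> e0.
have qrp : cross (r - q) (p - q) != 0 by rewrite cross_cycle.
have rpq : cross (p - r) (q - r) != 0 by rewrite cross_cycle.
pose A : set R[i] := [set z | [/\ - e < bary p q r z, - e < bary q r p z,
  0 < bary r p q z & bary p q r z < 0]].
pose B : set R[i] := [set z | [/\ - e < bary p q r z, - e < bary q r p z,
  0 < bary r p q z & bary q r p z < 0]].
have -> : collar e = A `|` B.
  by apply/seteqP; split=> z; [move=> [? ? ? [?|?]]; [left|right]|
    move=> [[]|[]] ? ? ? ?; split=> //; [left|right]].
pose g := (- (e / 2))%:C * p + (- (e / 2))%:C * q + (1 + e)%:C * r.
have [|gp gq gr] := bary_comb pqr (_ : - (e / 2) + - (e / 2) + (1 + e) = 1); first lra.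
apply: (@connectedC_setU _ _ _ g).
- apply: convexC_connected => x y t [? ? ? ?] [? ? ? ?] t01.
  by split; rewrite bary_shift //; first [exact: gt_segment|exact: lt_segment].
- apply: convexC_connected => x y t [? ? ? ?] [? ? ? ?] t01.
  by split; rewrite bary_shift //; first [exact: gt_segment|exact: lt_segment].
- by split; rewrite ?gp ?gq ?gr; lra.
- by split; rewrite ?gp ?gq ?gr; lra.
Qed.

(** The triangle dilated by [1 + 3 * e] about its centroid is cut out by the
    inequalities [- e <= bary _ _ _ z]. *)
Lemma triangle_margin (O : set R[i]) : open O -> triangle p q r `<=` O ->
  exists2 e : R, 0 < e & forall z, - e < bary p q r z -> - e < bary q r p z ->
    - e < bary r p q z -> O z.
Proof.
move=> oO TO; have [d d0 hd] := compact_open_margin compact_triangle oO TO.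
pose M := normc p + normc q + normc r.
have M0 : 0 <= M by rewrite !addr_ge0 ?normc_ge0.
pose e := d / (6 * (M + 1)).
have e0 : 0 < e by rewrite divr_gt0 //; lra.
exists e => // z hp hq hr.
pose g := (1 / 3)%:C * p + (1 / 3)%:C * q + (1 / 3)%:C * r.
have g3 : 1 / 3 + 1 / 3 + 1 / 3 = 1 :> R by lra.
have [gp gq gr] := bary_comb pqr g3.
have Tg : triangle p q r g by exists (1/3), (1/3), (1/3); split=> //; lra.
have e3 : 0 < 1 + 3 * e by lra.
pose z' := g + ((1 + 3 * e)^-1)%:C * (z - g).
have Tz' : triangle p q r z'.
  have qrp : cross (r - q) (p - q) != 0 by rewrite cross_cycle.
  have rpq : cross (p - r) (q - r) != 0 by rewrite cross_cycle.
  have bz (b : R) : - e < b -> 0 <= 1 / 3 + (1 + 3 * e)^-1 * (b - 1 / 3).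
    move=> hb; have -> : 1 / 3 + (1 + 3 * e)^-1 * (b - 1 / 3) = (b + e) / (1 + 3 * e).
      by field; rewrite gt_eqF.
    by rewrite divr_ge0 //; lra.
  by apply/triangleP; rewrite /z' !bary_shift // gp gq gr; split; exact: bz.
apply: (hd z' z) => //.
have -> : z - z' = (3 * e)%:C * (z' - g).
  have zg : z - g = (1 + 3 * e)%:C * (z' - g).
    rewrite /z' [X in _ * X]addrC addKr mulrA -rmorphM divff ?gt_eqF //.
    by rewrite rmorph1 mul1r.
  have -> : z - z' = (z - g) - (z' - g) by ring.
  by rewrite zg rmorphD /= rmorph1; ring.
rewrite normcM normc_real gtr0_norm; last by lra.
have h1 := triangle_normc Tz'; have h2 := triangle_normc Tg.
have h3 := normcD z' (- g); rewrite normc_opp in h3.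
apply: le_lt_trans (_ : 3 * e * (2 * M) < _).
  by apply: ler_wpM2l; rewrite /M; lra.
rewrite /e -subr_gt0.
have -> : d - 3 * (d / (6 * (M + 1))) * (2 * M) = d / (M + 1).
  by field; rewrite gt_eqF //; lra.
by rewrite divr_gt0 //; lra.
Qed.

End NondegenerateTriangle.
End Barycentric.

(** * Geometry of a slit trapezoid *)

Section SlitGeometry.
Variables (R : realType) (a : nat -> R) (x0 h : R).
Hypothesis a_incr : forall n, a n < a n.+1.
Hypothesis a_cvg : a n @[n --> \oo] --> x0.
Hypothesis h_gt0 : 0 < h.
Implicit Types (z : R[i]).

Lemma a_le i j : (i <= j)%N -> a i <= a j.
Proof.
by move=> ij; rewrite (homo_leq (f := a) (r := <=%O)) // => [? ? ?|n];
  [exact: le_trans|exact: ltW].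
Qed.

Lemma a_lt_lim n : a n < x0.
Proof.
apply: lt_le_trans (a_incr n) _; rewrite -(cvg_lim _ a_cvg) //.
by apply: nondecreasing_cvgn_le; [move=> i j; exact: a_le|exact: cvgP a_cvg].
Qed.

(** Height of the hypotenuse above [s]. *)
Definition top (s : R) := h * (x0 - s) / (x0 - a 0).
(** Vertical distance below the hypotenuse; up to a factor it is the barycentric
    coordinate at the tip of every slit, see [bary_tip]. *)
Definition depth z := top (complex.Re z) - complex.Im z.

Lemma base_gt0 : 0 < x0 - a 0.
Proof. by have := a_lt_lim 0%N; lra. Qed.

Lemma top_slope s t : top s - top t = h / (x0 - a 0) * (t - s).
Proof. by have := base_gt0 => L; rewrite /top; field; rewrite gt_eqF. Qed.

Lemma top_gt0 s : s < x0 -> 0 < top s.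
Proof.
by move=> hs; rewrite divr_gt0 ?base_gt0 // mulr_gt0 // subr_gt0.
Qed.

Lemma bigTP z : bigT a x0 h z <->
  [/\ a 0 <= complex.Re z, 0 <= complex.Im z & 0 <= depth z].
Proof.
have L := base_gt0; rewrite /bigT.
have c0 : cross ((a 0 +i* h) - (a 0 +i* 0)) ((x0 +i* 0) - (a 0 +i* 0)) != 0.
  rewrite /cross /= (_ : _ - _ = - (h * (x0 - a 0))); last by ring.
  by rewrite oppr_eq0 mulf_neq0 // gt_eqF.
rewrite triangleP // /depth /top.
have h0 : h != 0 by rewrite gt_eqF.
have L0 : x0 - a 0 != 0 by rewrite gt_eqF.
have -> : bary (a 0 +i* 0) (a 0 +i* h) (x0 +i* 0) z =
    (h * (x0 - complex.Re z) / (x0 - a 0) - complex.Im z) / h.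
  by case: z => x y; rewrite /bary /cross /=; field; rewrite ?h0 ?L0.
have -> : bary (a 0 +i* h) (x0 +i* 0) (a 0 +i* 0) z = complex.Im z / h.
  by case: z => x y; rewrite /bary /cross /=; field; rewrite h0 subrr mulr0 subr0
    mulf_neq0 ?oppr_eq0.
have -> : bary (x0 +i* 0) (a 0 +i* 0) (a 0 +i* h) z =
    (complex.Re z - a 0) / (x0 - a 0).
  have L2 : a 0 - x0 != 0 by rewrite -opprB oppr_eq0.
  by case: z => x y; rewrite /bary /cross /= ?subr0 ?subrr ?mul0r ?subr0; field;
    rewrite ?h0 ?L0 ?L2.
by rewrite !pmulr_lge0 ?invr_gt0 // !subr_ge0; split=> -[? ? ?]; split.
Qed.

Lemma continuous_depth : continuous depth.
Proof.
rewrite (_ : depth = fun z => - (h / (x0 - a 0)) * complex.Re z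
    + (-1) * complex.Im z + h * x0 / (x0 - a 0)); first exact: continuous_affineC.
have L0 : x0 - a 0 != 0 by rewrite gt_eqF // base_gt0.
by apply/funext => z; rewrite /depth /top; field.
Qed.

Lemma depth_shift z x y (t : R) :
  depth (z + t%:C * (y - x)) = depth z + t * (depth y - depth x).
Proof.
have L0 : x0 - a 0 != 0 by rewrite gt_eqF // base_gt0.
by case: z x y => [? ?] [? ?] [? ?]; rewrite /depth /top /=; field.
Qed.

Lemma Re_line z z' (t : R) : complex.Re (z + t%:C * (z' - z)) =
  complex.Re z + t * (complex.Re z' - complex.Re z).
Proof. by case: z z' => [? ?] [? ?] /=; ring. Qed.

Lemma Im_line z z' (t : R) : complex.Im (z + t%:C * (z' - z)) =
  complex.Im z + t * (complex.Im z' - complex.Im z).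
Proof. by case: z z' => [? ?] [? ?] /=; ring. Qed.

Lemma cross_slope l r z :
  cross (slope a x0 h l - z) (slope a x0 h r - z) = - ((r - l) * depth z).
Proof.
have L0 : x0 - a 0 != 0 by rewrite gt_eqF // base_gt0.
by case: z => x y; rewrite /depth /top /slope /cross /=; field.
Qed.

Lemma trapezoidP n z : trapezoid a x0 h n z <->
  [/\ a n <= complex.Re z, complex.Re z <= a n.+1, 0 <= complex.Im z & 0 <= depth z].
Proof.
rewrite /trapezoid /= bigTP; split.
- by move=> [[? ? ?] /andP[? ?]].
- move=> [h1 h2 h3 h4]; split; last by rewrite h1 h2.
  by split=> //; apply: le_trans h1; exact: a_le.
Qed.

Definition open_trapezoid n : set R[i] := [set z | [/\ a n < complex.Re z,
  complex.Re z < a n.+1, 0 < complex.Im z & 0 < depth z]].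

Lemma open_trapezoid_connected n : connectedC (open_trapezoid n).
Proof.
apply: convexC_connected => x y t [? ? ? ?] [? ? ? ?] t01.
by split; rewrite ?Re_line ?Im_line ?depth_shift;
  first [exact: gt_segment|exact: lt_segment].
Qed.

Lemma open_trapezoid_open n : open (open_trapezoid n).
Proof.
have gt_open (phi : R[i] -> R) b : continuous phi -> open [set z | b < phi z].
  move=> cphi; apply: (@open_comp _ _ phi [set t | b < t]) => [z _|]; first exact: cphi.
  exact: open_gt.
have lt_open (phi : R[i] -> R) b : continuous phi -> open [set z | phi z < b].
  move=> cphi; apply: (@open_comp _ _ phi [set t | t < b]) => [z _|]; first exact: cphi.
  exact: open_lt.
rewrite (_ : open_trapezoid n = [set z | a n < complex.Re z] `&`
   ([set z | complex.Re z < a n.+1] `&` ([set z | 0 < complex.Im z] `&`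
    [set z | 0 < depth z]))); last first.
  by apply/seteqP; split=> z /=; [move=> [? ? ? ?]|move=> [? [? [? ?]]]].
by do 3?[apply: openI]; first [apply: gt_open|apply: lt_open];
  solve [exact: continuous_ReC|exact: continuous_ImC|exact: continuous_depth].
Qed.

Lemma trapezoid_interior n z : (trapezoid a x0 h n)° z -> open_trapezoid n z.
Proof.
move=> /nbhs_normcP[e e0 he].
have step (d : R[i]) : normc d = e / 2 -> trapezoid a x0 h n (z + d).
  by move=> hd; apply: he; rewrite addrC addKr hd; lra.
have e2 : 0 < e / 2 by lra.
have re1 : normc ((e / 2)%:C) = e / 2 by rewrite normc_real gtr0_norm.
have i1 : normc (0 +i* (e / 2)) = e / 2.
  by rewrite /= expr0n add0r sqrtr_sqr gtr0_norm.
have /trapezoidP[_ h1 _ _] := step _ re1.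
have /trapezoidP[h2 _ _ _] : trapezoid a x0 h n (z + - (e / 2)%:C).
  by apply: step; rewrite normc_opp.
have /trapezoidP[_ _ _ h3] := step _ i1.
have /trapezoidP[_ _ h4 _] : trapezoid a x0 h n (z + - (0 +i* (e / 2))).
  by apply: step; rewrite normc_opp.
by move: h1 h2 h3 h4; case: (z) => x y /=; rewrite /depth /= ?addr0 => *; split=> //=;
  rewrite /depth /=; lra.
Qed.

Section OneTrapezoid.
Variables (n : nat) (l r : nat -> R) (w : nat -> R[i]).
Hypothesis slits : slit_sequence a x0 h n l r w.

Let S k : set R[i] := slit a x0 h (l k) (r k) (w k).
Let p k := slope a x0 h (l k).
Let q k := slope a x0 h (r k).

Lemma tipP k : open_trapezoid n (w k).
Proof. exact: trapezoid_interior (slit_tip slits k). Qed.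

Lemma slope_vedge m s : a m = s -> vedge a x0 h m (slope a x0 h s).
Proof.
move=> <-; split=> //; apply/bigTP; rewrite /depth /= -/(top _) subrr.
by split=> //; [exact: a_le|apply: ltW; apply: top_gt0; exact: a_lt_lim].
Qed.

Lemma slit_vertex_right k : S k (q k).
Proof.
by exists 0, 1, 0;
  split; rewrite ?ler01 ?lexx ?rmorph0 ?rmorph1 ?mul0r ?mul1r ?addr0 ?add0r.
Qed.

Lemma slit_ends k : [/\ a n < l k, l k < r k & r k < a n.+1].
Proof.
have [h1 h2 h3] := slit_base slits k; have [h4 h5 _] := slit_base slits k.+1.
have h6 := slit_ordered slits k; split=> //; first lra.
rewrite lt_neqAle h3 andbT; apply/eqP => rE.
have Sq := slit_vertex_right k.
have : (S k `&` vedge a x0 h n.+1) (q k) by split=> //; exact: slope_vedge.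
by rewrite (slit_right slits).
Qed.

Lemma slit_ndeg k : cross (q k - p k) (w k - p k) != 0.
Proof.
rewrite -(cross_cycle (p k)) -cross_cycle cross_slope oppr_eq0.
have [_ h1 _] := slit_ends k; have [_ _ _ h2] := tipP k.
by rewrite mulf_neq0 // gt_eqF // subr_gt0.
Qed.

Lemma bary_tip k z : bary (w k) (p k) (q k) z = depth z / depth (w k).
Proof.
have [_ h1 _] := slit_ends k; have [_ _ _ h2] := tipP k.
rewrite /bary !cross_slope -!mulNr -mulf_div divff ?mul1r //.
by rewrite oppr_eq0 gt_eqF // subr_gt0.
Qed.

Lemma bary_tip_gt0 k z : (0 < bary (w k) (p k) (q k) z) = (0 < depth z).
Proof. by rewrite bary_tip pmulr_lgt0 // invr_gt0; case: (tipP k). Qed.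

Lemma bary_tip_ge0 k z : (0 <= bary (w k) (p k) (q k) z) = (0 <= depth z).
Proof. by rewrite bary_tip pmulr_lge0 // invr_gt0; case: (tipP k). Qed.

Lemma slit_Re_lt k b z : S k z -> r k < b -> complex.Re (w k) < b ->
  complex.Re z < b.
Proof.
move=> [u [v [t [u0 v0 t0 uvt ->]]]] rb wb.
have [_ lr _] := slit_ends k.
have := comb_lt u0 v0 t0 uvt (lt_trans lr rb) rb wb.
by case: (w k) => x y /=; rewrite !mul0r !subr0.
Qed.

Lemma slit_strip k z : S k z -> [/\ a n < complex.Re z, complex.Re z < a n.+1,
  0 < complex.Im z & 0 <= depth z].
Proof.
move=> Sz; have [al lr ra] := slit_ends k; have [w1 w2 w3 w4] := tipP k.
split; last 1 first.
- by rewrite -(bary_tip_ge0 k); move/(triangleP (slit_ndeg k)): Sz => [].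
- move: Sz => [u [v [t [u0 v0 t0 uvt ->]]]].
  have := comb_lt u0 v0 t0 uvt (_ : - l k < - a n) (_ : - r k < - a n)
    (_ : - complex.Re (w k) < - a n).
  by case: (w k) w1 => x y /= w1; rewrite !mul0r !subr0 !mulrN => /(_ _ _ _); lra.
- exact: slit_Re_lt Sz ra w2.
- move: Sz => [u [v [t [u0 v0 t0 uvt ->]]]].
  have ax := a_lt_lim n.+1.
  have tl : - top (l k) < 0 by rewrite oppr_lt0 top_gt0 //; lra.
  have tr : - top (r k) < 0 by rewrite oppr_lt0 top_gt0 //; lra.
  have tw : - complex.Im (w k) < 0 by rewrite oppr_lt0.
  have := comb_lt u0 v0 t0 uvt tl tr tw.
  by case: (w k) => x y /=; rewrite -!/(top _) !mul0r !addr0; lra.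
Qed.

Lemma slit_base_cvg e : 0 < e -> exists N, forall k, (N <= k)%N ->
  [/\ r k < a n + e, normc (w k - (a n +i* 0)) < e & complex.Re (w k) < a n + e].
Proof.
move=> e0; have [N1 h1] := cvg_eventuallyC (slit_base_right_cvg slits) e0.
have [N2 h2] := cvg_eventuallyC (slit_tip_cvg slits) e0.
exists (maxn N1 N2) => k; rewrite geq_max => /andP[/h1 k1 /h2 k2].
have := le_lt_trans (Re_le_normc _) k1; have := le_lt_trans (Re_le_normc _) k2.
rewrite !ltr_norml /=; case: (w k) k2 => x y /= k2 /andP[? ?] /andP[? ?].
by split=> //; lra.
Qed.

(** The slits accumulate only at the left edge. *)
Lemma slits_locally_finite (J : nat -> Prop) z : a n < complex.Re z ->
  (forall k, J k -> ~ S k z) ->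
  exists2 e : R, 0 < e & forall z', normc (z' - z) < e -> forall k, J k -> ~ S k z'.
Proof.
move=> az nS; pose d := (complex.Re z - a n) / 2.
have d0 : 0 < d by rewrite /d; lra.
have [N hN] := slit_base_cvg d0.
have [e e0 he] : exists2 e : R, 0 < e & forall z', normc (z' - z) < e ->
    forall k, (k < N)%N -> J k -> ~ S k z'.
  elim: N {hN} => [|N [e e0 IH]]; first by exists 1.
  have [JN|nJN] := pselect (J N); last first.
    exists e => // z' hz' k; rewrite ltnS leq_eqVlt => /orP[/eqP -> //|kN].
    exact: IH.
  have : nbhs z (~` S N).
    apply: open_nbhs_nbhs; split; last exact: nS.
    by apply: closed_openC; exact: closed_triangle (slit_ndeg N).
  move=> /nbhs_normcP[e' e'0 he']; exists (Num.min e e').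
    by rewrite lt_min e0.
  move=> z'; rewrite lt_min => /andP[hz' hz'2] k.
  rewrite ltnS leq_eqVlt => /orP[/eqP -> _|kN]; first exact: he'.
  exact: IH.
exists (Num.min e d); first by rewrite lt_min e0.
move=> z'; rewrite lt_min => /andP[h1 h2] k Jk.
have [kN|Nk] := ltnP k N; first exact: he.
have [k1 _ k2] := hN k Nk.
move=> Sz'; have := slit_Re_lt Sz' k1 k2.
have := le_lt_trans (Re_le_normc _) h2; rewrite ltr_norml.
by case: (z') (z) @d {d0 h2 hN k1 k2 az nS he h1 Sz'} => x' y' [x y] d /=; rewrite /d /=; lra.
Qed.

Definition slit_domain : set R[i] :=
  [set z | open_trapezoid n z /\ forall k, ~ S k z].

Lemma slit_disjointP j k z : S j z -> S k z -> j = k.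
Proof.
by move=> Sj Sk; apply: (slit_disjoint slits (i := j) (j := k)) => //; exists z.
Qed.

(** A slit is compact and, away from the left edge, separated from the others, so
    a slightly dilated triangle meets no other slit. *)
Lemma slit_collar k : exists2 e : R, 0 < e & forall z,
  - e < bary (p k) (q k) (w k) z -> - e < bary (q k) (w k) (p k) z ->
  0 < depth z -> open_trapezoid n z /\ forall j, j <> k -> ~ S j z.
Proof.
pose O : set R[i] := [set z | [/\ a n < complex.Re z, complex.Re z < a n.+1,
  0 < complex.Im z & forall j, j <> k -> ~ S j z]].
have oO : open O.
  apply/open_normcP => z [z1 z2 z3 z4].
  have [e e0 he] := slits_locally_finite z1 z4.
  exists (Num.min e (Num.min (complex.Re z - a n)
      (Num.min (a n.+1 - complex.Re z) (complex.Im z)))).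
    by rewrite !lt_min e0 !subr_gt0 z1 z2.
  move=> z'; rewrite !lt_min => /andP[h1 /andP[h2 /andP[h3 h4]]].
  have := Re_le_normc (z' - z); have := Im_le_normc (z' - z).
  have -> : complex.Re (z' - z) = complex.Re z' - complex.Re z.
    by case: (z') (z) => [? ?] [? ?].
  have -> : complex.Im (z' - z) = complex.Im z' - complex.Im z.
    by case: (z') (z) => [? ?] [? ?].
  rewrite !ler_norml => /andP[i1 i2] /andP[r1 r2].
  by split; [lra|lra|lra|exact: he].
have SO : S k `<=` O.
  move=> z Sz; have [z1 z2 z3 _] := slit_strip Sz; split=> // j jk Sj.
  exact/jk/(slit_disjointP Sj Sz).
have [e e0 he] := triangle_margin (slit_ndeg k) oO SO.
exists e => // z h1 h2 h3.
have h4 : - e < bary (w k) (p k) (q k) z.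
  by apply: lt_trans (_ : 0 < _); [rewrite oppr_lt0|rewrite bary_tip_gt0].
by have [z1 z2 z3 z4] := he z h1 h2 h4; split.
Qed.

Lemma collar_domain k e z : (forall z,
  - e < bary (p k) (q k) (w k) z -> - e < bary (q k) (w k) (p k) z ->
  0 < depth z -> open_trapezoid n z /\ forall j, j <> k -> ~ S j z) ->
  collar (p k) (q k) (w k) e z -> slit_domain z.
Proof.
move=> he [h1 h2 h3 h4]; rewrite bary_tip_gt0 in h3.
have [Fz nS] := he z h1 h2 h3; split=> // j.
have [->|/eqP/nS //] := eqVneq j k.
by move=> /(triangleP (slit_ndeg k))[? ? _]; case: h4 => ?; lra.
Qed.

(** A locally constant property of the slit domain is constant on the collar of
    each slit, so it can be extended across the slit; the extension is locally
    constant on the convex trapezoid. *)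
Lemma slit_domain_connected : connectedC slit_domain.
Proof.
move=> P lP x y Dx Dy Px.
have [e he] := choice (fun k => let: ex_intro2 e e0 H := slit_collar k in
  ex_intro (fun e => 0 < e /\ _) e (conj e0 H)).
pose V k : set R[i] := collar (p k) (q k) (w k) (e k).
have VD k : V k `<=` slit_domain by move=> z; apply: collar_domain (he k).2.
have Vconst k u v : V k u -> V k v -> P u -> P v.
  move=> Vu Vv; apply: (collar_connected (slit_ndeg k) (he k).1) => //.
  exact: locally_constant_subset (VD k) lP.
pose P' z := (slit_domain z /\ P z) \/
  exists k, S k z /\ exists2 u, V k u & P u.
have P'D z : slit_domain z -> (P' z <-> P z).
  move=> Dz; split=> [[[]|[k [Sz]]] //|]; last by left.
  by case: Dz => _ /(_ k).
have P'S k z : S k z -> (P' z <-> exists2 u, V k u & P u).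
  move=> Sz; split=> [[[[_ /(_ k)]]|[j [Sj]]] //|]; last by right; exists k.
  by rewrite (slit_disjointP Sj Sz).
have lP' : locally_constant (open_trapezoid n) P'.
  move=> z Fz; have [z1 _ _ z4] := Fz.
  have [[k Sz]|nS] := pselect (exists k, S k z); last first.
    have Dz : slit_domain z by split=> // k Sz; apply: nS; exists k.
    have [d d0 hd] := lP z Dz.
    have [d' d'0 hd'] := slits_locally_finite (J := fun=> True) z1 (fun k _ => Dz.2 k).
    exists (Num.min d d'); first by rewrite lt_min d0.
    move=> z' Fz'; rewrite lt_min => /andP[h1 h2].
    have Dz' : slit_domain z' by split=> // k; exact: hd'.
    by rewrite !P'D //; exact: hd.
  have /(triangleP (slit_ndeg k))[bp bq _] := Sz.
  have : nbhs z [set z' | - e k < bary (p k) (q k) (w k) z' /\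
      - e k < bary (q k) (w k) (p k) z'].
    have ek := (he k).1.
    apply: filterI.
      apply: (@continuous_bary _ (p k) (q k) (w k) z [set t | - e k < t]).
      by apply: lt_nbhsr; lra.
    apply: (@continuous_bary _ (q k) (w k) (p k) z [set t | - e k < t]).
    by apply: lt_nbhsr; lra.
  move=> /nbhs_normcP[d d0 hd]; exists d => // z' Fz' /hd[h1 h2].
  rewrite (P'S _ _ Sz).
  have [Sz'|nSz'] := pselect (S k z'); first by rewrite (P'S _ _ Sz').
  have [_ _ _ dz'] := Fz'.
  have Vz' : V k z'.
    split=> //; first by rewrite bary_tip_gt0.
    have [?|b1] := ltP (bary (p k) (q k) (w k) z') 0; first by left.
    have [?|b2] := ltP (bary (q k) (w k) (p k) z') 0; first by right.
    case: nSz'; apply/(triangleP (slit_ndeg k)); split=> //.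
    by rewrite bary_tip_ge0 ltW.
  rewrite P'D; last exact: VD Vz'.
  by split=> [Pz'|[u Vu Pu]]; [exists z'|exact: Vconst _ _ _ Vu Vz' Pu].
apply/(P'D _ Dy); apply: (open_trapezoid_connected lP' Dx.1 Dy.1).
exact/P'D.
Qed.

Lemma slit_domain_open : open slit_domain.
Proof.
apply/open_normcP => z [Fz nS]; have [z1 _ _ _] := Fz.
have [d d0 hd] := slits_locally_finite (J := fun=> True) z1 (fun k _ => nS k).
have [d' d'0 hd'] : exists2 e : R, 0 < e &
    forall z', normc (z' - z) < e -> open_trapezoid n z'.
  by have /open_normcP/(_ z Fz) := @open_trapezoid_open n.
exists (Num.min d d'); first by rewrite lt_min d0.
move=> z'; rewrite lt_min => /andP[h1 h2]; split; first exact: hd'.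
by move=> k; exact: hd.
Qed.

Lemma slit_removed_sub k : slit_removed a x0 h (l k) (r k) (w k) `<=` S k.
Proof.
move=> z [/interior_subset //|[t /andP[t0 t1] ->]].
exists (1 - t), t, 0; split; rewrite ?subr_ge0 ?lexx ?ltW //; first by ring.
by rewrite rmorph0 mul0r addr0.
Qed.

Lemma slit_domain_sub : slit_domain `<=` slitK a x0 h n l r w.
Proof.
move=> z [[z1 z2 z3 z4] nS]; split; first by apply/trapezoidP; split; exact: ltW.
by move=> [k _ /slit_removed_sub]; exact: nS.
Qed.

Lemma slit_removedP k z : 0 < bary (p k) (q k) (w k) z ->
  0 < bary (q k) (w k) (p k) z -> 0 <= depth z ->
  slit_removed a x0 h (l k) (r k) (w k) z.
Proof.
move=> bp bq; rewrite le_eqVlt => /orP[/eqP dz|dz]; last first.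
  by left; apply: triangle_interior; rewrite ?slit_ndeg // bary_tip_gt0.
right; have bw : bary (w k) (p k) (q k) z = 0 by rewrite bary_tip -dz mul0r.
have bs := bary_sum z (slit_ndeg k); rewrite bw addr0 in bs.
exists (bary (q k) (w k) (p k) z); first by rewrite bq /=; lra.
rewrite {1}(baryE z (slit_ndeg k)) bw rmorph0 mul0r addr0.
by congr (_%:C * _ + _); lra.
Qed.

(** From a point of a side of the slit, moving parallel to the other side and
    out of the triangle enters the collar. *)
Lemma slit_side_closure k z : S k z ->
  bary (p k) (q k) (w k) z = 0 \/ bary (q k) (w k) (p k) z = 0 ->
  forall e : R, 0 < e -> exists2 z', slit_domain z' & normc (z' - z) < e.
Proof.
move=> Sz side e e0; have [d d0 hd] := slit_collar k.
have nd := slit_ndeg k.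
have nd1 : cross (w k - q k) (p k - q k) != 0 by rewrite cross_cycle.
have /(triangleP nd)[bp bq] := Sz; rewrite bary_tip_ge0 => bw.
have [_ _ _ dw] := tipP k.
have [pp pq pw] := bary_vertex nd.
have [qq qw qp] := bary_vertex nd1.
have depth0 s : depth (slope a x0 h s) = 0 by rewrite /depth /= -/(top _) subrr.
case: side => side.
- have [t t0 ht] := normc_small (w k - p k) e0.
  pose s := Num.min t (d / 2); have s0 : 0 < s by rewrite lt_min t0; lra.
  have [st sd] : s <= t /\ s <= d / 2 by rewrite /s !ge_min !lexx orbT.
  exists (z + s%:C * (w k - p k)); last first.
    by rewrite addrC addKr; apply: ht; rewrite s0.
  apply: (collar_domain hd); split.
  + by rewrite bary_shift side pw pp; lra.
  + by rewrite bary_shift qw qp; lra.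
  + rewrite bary_tip_gt0 depth_shift depth0; have := mulr_gt0 s0 dw; lra.
  + by left; rewrite bary_shift side pw pp; lra.
- have [t t0 ht] := normc_small (w k - q k) e0.
  pose s := Num.min t (d / 2); have s0 : 0 < s by rewrite lt_min t0; lra.
  have [st sd] : s <= t /\ s <= d / 2 by rewrite /s !ge_min !lexx orbT.
  exists (z + s%:C * (w k - q k)); last first.
    by rewrite addrC addKr; apply: ht; rewrite s0.
  apply: (collar_domain hd); split.
  + by rewrite bary_shift pw pq; lra.
  + by rewrite bary_shift side qw qq; lra.
  + rewrite bary_tip_gt0 depth_shift depth0; have := mulr_gt0 s0 dw; lra.
  + by right; rewrite bary_shift side qw qq; lra.
Qed.

Lemma trapezoid_line z t : trapezoid a x0 h n z -> 0 < t <= 1 ->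
  open_trapezoid n (z + t%:C * (w 0 - z)).
Proof.
move=> /trapezoidP[z1 z2 z3 z4] /andP[t0 t1]; have [w1 w2 w3 w4] := tipP 0.
by split; rewrite ?Re_line ?Im_line ?depth_shift; nra.
Qed.

(** The interior of [K_n] reaches even the left edge, because the slits do: both
    sides of every slit are limits of points of the slit domain. *)
Lemma slitK_closure z : slitK a x0 h n l r w z ->
  forall e : R, 0 < e -> exists2 z', slit_domain z' & normc (z' - z) < e.
Proof.
move=> [Tz nrem] e e0; have /trapezoidP[z1 z2 z3 z4] := Tz.
have [[k Sz]|nS] := pselect (exists k, S k z).
  apply: (slit_side_closure Sz) => //.
  have /(triangleP (slit_ndeg k))[bp bq bw] := Sz.
  have [->|bp0] := eqVneq (bary (p k) (q k) (w k) z) 0; first by left.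
  have [->|bq0] := eqVneq (bary (q k) (w k) (p k) z) 0; first by right.
  case: nrem; exists k => //; apply: slit_removedP => //.
  + by rewrite lt_def bp0.
  + by rewrite lt_def bq0.
move: z1; rewrite le_eqVlt => /orP[/eqP zE|z1]; last first.
  have nS' k : True -> ~ S k z by move=> _ Sz; apply: nS; exists k.
  have [d d0 hd] := slits_locally_finite z1 nS'.
  have m0 : 0 < Num.min d e by rewrite lt_min d0.
  have [t t0 ht] := normc_small (w 0 - z) m0.
  pose s := Num.min t 1; have s0 : 0 < s by rewrite lt_min t0 ltr01.
  have [st s1] : s <= t /\ s <= 1 by rewrite /s !ge_min !lexx orbT.
  have := ht s; rewrite s0 st lt_min => /(_ isT)/andP[h1 h2].
  exists (z + s%:C * (w 0 - z)); last by rewrite addrC addKr.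
  split; first by apply: trapezoid_line => //; rewrite s0.
  by move=> k; apply: hd => //; rewrite addrC addKr.
(* The point of height [y] on the left edge is the limit of the points of the
   left sides of the slits that divide them in the same ratio. *)
pose H := top (a n); have H0 : 0 < H by apply: top_gt0; exact: a_lt_lim.
pose s := 1 - complex.Im z / H.
have zH : complex.Im z <= H by move: z4; rewrite /depth -zE /H; lra.
have s0 : 0 <= s by rewrite /s subr_ge0 ler_pdivrMr // mul1r.
have s1 : s <= 1 by rewrite /s gerDl oppr_le0 divr_ge0 // ltW.
have e4 : 0 < e / 4 by lra.
have [N1 h1] := cvg_eventuallyC (slit_base_left_cvg slits) e4.
have [N2 h2] := cvg_eventuallyC (slit_tip_cvg slits) e4.
pose k := maxn N1 N2.
have {}h1 := h1 k (leq_maxl _ _); have {}h2 := h2 k (leq_maxr _ _).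
pose u := (1 - s)%:C * p k + 0%:C * q k + s%:C * w k.
have us : (1 - s) + 0 + s = 1 by lra.
have [up uq _] := bary_comb (slit_ndeg k) us.
have Su : S k u by exists (1 - s), 0, s; split=> //; lra.
have e2 : 0 < e / 2 by lra.
have [z' Dz' hz'] := slit_side_closure Su (or_intror uq) e2.
exists z' => //; have := normcD (z' - u) (u - z); rewrite subrKA.
suff : normc (u - z) <= e / 2 by lra.
have -> : u - z = (1 - s)%:C * (p k - slope a x0 h (a n)) +
    s%:C * (w k - (a n +i* 0)).
  have -> : z = (1 - s)%:C * slope a x0 h (a n) + s%:C * (a n +i* 0).
    have sH : (1 - s) * H = complex.Im z by rewrite /s; field; rewrite gt_eqF.
    apply/eqP; rewrite eq_complex /= -/(top _) -/H -zE !mul0r !subr0 !addr0 sH.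
    by rewrite mulr0 addr0 eqxx andbT; apply/eqP; ring.
  by rewrite /u rmorph0 mul0r addr0; ring.
have h3 := normcD ((1 - s)%:C * (p k - slope a x0 h (a n))) (s%:C * (w k - (a n +i* 0))).
have s1' : 1 - s <= 1 by lra.
have s0' : 0 <= 1 - s by lra.
rewrite !normcM !normc_real (ger0_norm s0') (ger0_norm s0) in h3.
have := ler_pM s0' (normc_ge0 _) s1' (ltW h1).
have := ler_pM s0 (normc_ge0 _) s1 (ltW h2).
rewrite -/(p k) in h1 *; lra.
Qed.

End OneTrapezoid.
End SlitGeometry.

(** * Propagation of zeros from right to left *)

Section ZeroPropagation.
Variables (R : realType) (a : nat -> R) (x0 h : R).
Hypothesis a_incr : forall n, a n < a n.+1.
Hypothesis a_cvg : a n @[n --> \oo] --> x0.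
Hypothesis h_gt0 : 0 < h.
Variables (l r : nat -> nat -> R) (w : nat -> nat -> R[i]).
Hypothesis slits : forall n, slit_sequence a x0 h n (l n) (r n) (w n).
Implicit Types (z y : R[i]).

Let X : set R[i] := slitX a x0 h l r w.
Let K n : set R[i] := slitK a x0 h n (l n) (r n) (w n).

Lemma slitK_sub n : K n `<=` X.
Proof. by move=> z Kz; right; exists n. Qed.

Variable f : R[i] -> R[i].
Hypothesis fX : ratfun X f.

Definition zero_near y := exists2 e : R, 0 < e &
  forall z, X z -> normc (z - y) < e -> f z = 0.

(** Vanishing near a point spreads over a disc of definite radius by
    [zero_on_disc], so it is both an open and a closed condition. *)
Lemma zero_near_locally_constant n :
  locally_constant (slit_domain a x0 h n (l n) (r n) (w n)) zero_near.
Proof.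
have fA : rapprox X f by exact/ratfunP.
move=> z Dz.
have /open_normcP/(_ z Dz)[e e0 he] := slit_domain_open a_incr a_cvg h_gt0 (slits n).
have eX y : normc (y - z) < e -> X y.
  by move=> /he Dy; apply: (@slitK_sub n); exact: (slit_domain_sub a_incr a_cvg h_gt0 Dy).
have spread x y : normc (x - z) < e / 4 -> normc (y - z) < e / 4 ->
    zero_near x -> zero_near y.
  move=> xz yz [d d0 hd].
  have discX v : normc (v - x) <= e / 2 -> X v.
    move=> vx; apply: eX; have := normcD (v - x) (x - z); rewrite subrKA; lra.
  have m0 : 0 < Num.min d (e / 2) by rewrite lt_min d0; lra.
  have f0 v : normc (v - x) < Num.min d (e / 2) -> f v = 0.
    by rewrite lt_min => /andP[h1 h2]; apply: hd => //; apply: discX; exact: ltW.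
  have fe := zero_on_disc fA m0 discX f0.
  have yx : normc (y - x) < e / 2.
    by have := normcD (y - z) (z - x); rewrite subrKA (normc_distC z); lra.
  exists (e / 2 - normc (y - x)); first lra.
  move=> v _ vy; apply: fe.
  by have := normcD (v - y) (y - x); rewrite subrKA; lra.
exists (e / 4); first lra.
move=> y _ yz; have zz : normc (z - z) < e / 4 by rewrite subrr normc0; lra.
by split; exact: spread.
Qed.

Lemma zero_on_slitK n y : K n y -> zero_near y -> forall z, K n z -> f z = 0.
Proof.
move=> Ky [e e0 he] z Kz.
have clos := slitK_closure a_incr a_cvg h_gt0 (slits n).
have DK := @slit_domain_sub R a x0 h a_incr a_cvg h_gt0 n (l n) (r n) (w n).
have Dopen := slit_domain_open a_incr a_cvg h_gt0 (slits n).
have [y' Dy' hy'] := clos y Ky e e0.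
have zy' : zero_near y'.
  exists (e - normc (y' - y)); first lra.
  move=> v Xv hv; apply: he => //.
  by have := normcD (v - y') (y' - y); rewrite subrKA; lra.
have f0 v : slit_domain a x0 h n (l n) (r n) (w n) v -> f v = 0.
  move=> Dv; have [d d0 hd] := slit_domain_connected a_incr a_cvg h_gt0 (slits n)
     (@zero_near_locally_constant n) Dy' Dv zy'.
  by apply: hd; [exact/slitK_sub/DK|rewrite subrr normc0].
apply/eqP; rewrite -normc_eq0; apply/negPn/negP => fz.
have {}fz : 0 < normc (f z) by rewrite lt_def fz normc_ge0.
have [fc _] := fX; move/continuous_normcP in fc.
have [d d0 hd] := fc z (slitK_sub Kz) _ fz.
have [v Dv vz] := clos z Kz d d0.
have := hd v (slitK_sub (DK _ Dv)) vz.
by rewrite f0 // sub0r normc_opp ltxx.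
Qed.

Lemma slits_right_gap n : exists2 b : R, a n <= b < a n.+1 &
  forall k z, slit a x0 h (l n k) (r n k) (w n k) z -> complex.Re z < b.
Proof.
have an := a_incr n; pose e := (a n.+1 - a n) / 2.
have e0 : 0 < e by rewrite /e; lra.
have [N hN] := slit_base_cvg (slits n) e0.
have [b [b1 b2 b3 hb]] : exists b, [/\ a n <= b, b < a n.+1, a n + e <= b &
    forall k, (k < N)%N -> r n k < b /\ complex.Re (w n k) < b].
  elim: N {hN} => [|N [b [b1 b2 b3 hb]]].
    by exists (a n + e); split=> //; rewrite /e; lra.
  have [_ _ h1] := slit_ends a_incr a_cvg h_gt0 (slits n) N.
  have [_ h2 _ _] := tipP a_incr a_cvg h_gt0 (slits n) N.
  pose m := Num.max b (Num.max (r n N) (complex.Re (w n N))).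
  have [m1 m2 m3] : [/\ b <= m, r n N <= m & complex.Re (w n N) <= m].
    by rewrite /m !le_max !lexx !orbT.
  have m4 : m < a n.+1 by rewrite /m !gt_max b2 h1.
  exists ((m + a n.+1) / 2); split; try lra.
  move=> k; rewrite ltnS leq_eqVlt => /orP[/eqP ->|/hb[? ?]]; lra.
exists b; first by rewrite b1.
move=> k z Sz; have [kN|Nk] := ltnP k N.
  by have [? ?] := hb k kN; exact: (slit_Re_lt a_incr a_cvg h_gt0 (slits n) Sz).
have [k1 _ k2] := hN k Nk.
by apply: (slit_Re_lt a_incr a_cvg h_gt0 (slits n) Sz); lra.
Qed.

(** The right edge of a piece is a free boundary arc, so a function vanishing
    there vanishes at the centres of small squares resting on it. *)
Lemma zero_on_previous_slitK n : (forall z, K n.+1 z -> f z = 0) ->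
  forall z, K n z -> f z = 0.
Proof.
move=> f0; have fA : rapprox X f by exact/ratfunP.
have [b /andP[b1 b2] hb] := slits_right_gap n.
have ax := a_lt_lim a_incr a_cvg n.+1.
pose H := top a x0 h (a n.+1).
have H0 : 0 < H by exact: top_gt0 a_incr a_cvg h_gt0 _ ax.
have topH s : s <= a n.+1 -> H <= top a x0 h s.
  move=> sa; have := @top_slope R a x0 h a_incr a_cvg s (a n.+1).
  have L := base_gt0 a_incr a_cvg.
  have : 0 <= h / (x0 - a 0) * (a n.+1 - s).
    by rewrite mulr_ge0 ?subr_ge0 // divr_ge0 // ltW.
  rewrite /H; lra.
pose d := Num.min ((a n.+1 - b) / 2) (H / 2).
have d0 : 0 < d by rewrite lt_min; apply/andP; split; lra.
have [d1 d2] : d <= (a n.+1 - b) / 2 /\ d <= H / 2 by rewrite /d !ge_min !lexx orbT.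
have KK z : b < complex.Re z -> complex.Re z <= a n.+1 -> 0 <= complex.Im z ->
    complex.Im z <= H -> K n z.
  move=> z1 z2 z3 z4; split.
    apply/(trapezoidP a_incr a_cvg h_gt0); split=> //; first lra.
    by rewrite /depth; have := topH _ z2; lra.
  move=> [k _ /slit_removed_sub/hb]; lra.
(* Centres close to [c0] have their square between the slits and the right edge,
   and the right side of that square lies on the right edge. *)
pose c0 := (a n.+1 - d / 2) +i* (H / 2).
apply: (zero_on_slitK (y := c0)); first by apply: KK => /=; lra.
exists (d / 4); first lra.
move=> c _ hc.
have hRe := le_lt_trans (Re_le_normc _) hc.
have hIm := le_lt_trans (Im_le_normc _) hc.
move: hRe hIm; rewrite !ltr_norml.
have -> : complex.Re (c - c0) = complex.Re c - (a n.+1 - d / 2) by case: (c).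
have -> : complex.Im (c - c0) = complex.Im c - H / 2 by case: (c).
move=> /andP[c1 c2] /andP[c3 c4].
have e0 : 0 < a n.+1 - complex.Re c by lra.
have ReB z : complex.Re (z - c) = complex.Re z - complex.Re c by case: (z) (c) => ? ? [].
have ImB z : complex.Im (z - c) = complex.Im z - complex.Im c by case: (z) (c) => ? ? [].
apply: (zero_at_square_center fA e0) => z; rewrite ReB ImB ?ler_norml.
  move=> /andP[z1 z2] /andP[z3 z4]; apply: (@slitK_sub n); apply: KK; lra.
move=> z1 /andP[z2 z3]; apply: f0; split.
  apply/(trapezoidP a_incr a_cvg h_gt0); have := a_incr n.+1.
  have zE : complex.Re z = a n.+1 by lra.
  by rewrite /depth zE -/H => ?; split; lra.
move=> [k _ /slit_removed_sub Sz].
have [? _ _ _] := slit_strip a_incr a_cvg h_gt0 (slits n.+1) Sz; lra.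
Qed.

Lemma zero_on_earlier_slitK n m y : (m <= n)%N -> K n y -> zero_near y ->
  forall z, K m z -> f z = 0.
Proof.
move=> mn Ky zy; have := zero_on_slitK Ky zy.
elim: n mn {Ky} => [|n IH]; first by rewrite leqn0 => /eqP ->.
rewrite leq_eqVlt => /orP[/eqP -> //|mn] f0.
by apply: IH => //; exact: zero_on_previous_slitK.
Qed.

End ZeroPropagation.

(** * The inverse Joukowski map *)

Section Joukowski.
Variable R : realType.
Implicit Types (v t z : R[i]) (Y : set R[i]).

(** The two solutions in [t] are inverse to each other; if neither lies in the
    open disc both are on the unit circle, where [v] is real with [normc v >= 1]. *)
Lemma joukowski_root v : (complex.Im v = 0 -> normc v < 1) ->
  exists2 t, normc t < 1 & v * (1 + t ^+ 2) = 2 * t.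
Proof.
move=> vP; have [->|v0] := eqVneq v 0.
  by exists 0; rewrite ?normc0 ?ltr01 // mul0r mulr0.
pose d := sqrtc (1 - v ^+ 2); have dd : d ^+ 2 = 1 - v ^+ 2 by exact: sqr_sqrtc.
pose t1 := (1 - d) / v; pose t2 := (1 + d) / v.
have e1 : v * (1 + t1 ^+ 2) = 2 * t1.
  have -> : v * (1 + t1 ^+ 2) = (v ^+ 2 + (1 - 2 * d + d ^+ 2)) / v.
    by rewrite /t1; field.
  by rewrite dd /t1; field.
have e2 : v * (1 + t2 ^+ 2) = 2 * t2.
  have -> : v * (1 + t2 ^+ 2) = (v ^+ 2 + (1 + 2 * d + d ^+ 2)) / v.
    by rewrite /t2; field.
  by rewrite dd /t2; field.
have t12 : t1 * t2 = 1.
  have -> : t1 * t2 = (1 - d ^+ 2) / v ^+ 2 by rewrite /t1 /t2; field.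
  by rewrite dd opprB addrCA subrr addr0 divff // expf_neq0.
have n12 : normc t1 * normc t2 = 1 by rewrite -normcM t12 normc1.
have [h1|h1] := ltP (normc t1) 1; first by exists t1.
have [h2|h2] := ltP (normc t2) 1; first by exists t2.
have n1 : normc t1 = 1 by have := normc_ge0 t1; nra.
have xy : complex.Re t1 ^+ 2 + complex.Im t1 ^+ 2 = 1.
  by rewrite -sqr_normcE n1 expr1n.
have t10 : t1 != 0 by rewrite -normc_gt0 n1 ltr01.
have vx : v * (complex.Re t1)%:C = 1.
  have E : 1 + t1 ^+ 2 = 2 * (complex.Re t1)%:C * t1.
    have -> : 1 + t1 ^+ 2 = (complex.Re t1 ^+ 2 + complex.Im t1 ^+ 2)%:C + t1 ^+ 2.
      by rewrite xy.
    case: (t1) => x y; apply/eqP.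
    by rewrite eq_complex /=; apply/andP; split; apply/eqP; ring.
  apply: (mulfI (_ : 2 * t1 != 0)); first by rewrite mulf_neq0 // pnatr_eq0.
  have -> : 2 * t1 * (v * (complex.Re t1)%:C) = v * (2 * (complex.Re t1)%:C * t1).
    by ring.
  by rewrite -E e1 mulr1.
have x0 : complex.Re t1 != 0.
  by apply/eqP => x0; move: vx; rewrite x0 mulr0 => /eqP; rewrite eq_sym oner_eq0.
have vE : v = ((complex.Re t1)^-1)%:C.
  apply: (mulIf (_ : (complex.Re t1)%:C != 0)); first by rewrite fmorph_eq0.
  by rewrite vx -rmorphM mulVf.
have := vP _; rewrite vE => /(_ erefl); rewrite normc_real normfV.
rewrite invf_lt1 ?normr_gt0 // => h; have := Re_le_normc t1; lra.
Qed.

Section Bounds.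
Variables v t : R[i].
Hypotheses (t1 : normc t < 1) (vt : v * (1 + t ^+ 2) = 2 * t).

Lemma joukowski_nz : 0 < normc (1 + t ^+ 2).
Proof.
have := normcD (1 + t ^+ 2) (- t ^+ 2); rewrite addrK normc1 normc_opp normcX.
have : normc t ^+ 2 < 1 by rewrite expr_lt1 ?normc_ge0.
lra.
Qed.

Lemma joukowski_normc : normc v * normc (1 + t ^+ 2) = 2 * normc t.
Proof. by rewrite -normcM vt normcM normc_two. Qed.

(** [normc t] is determined by the ellipse with foci [-1], [1] through [v]. *)
Lemma joukowski_ellipse : normc t <= 2 * normc v / (normc (1 - v) + normc (1 + v)) < 1.
Proof.
have N0 := joukowski_nz; set N := normc (1 + t ^+ 2) in N0 *.
have hv : normc v * N = 2 * normc t by exact: joukowski_normc.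
have h1 : normc (1 - v) * N = normc (1 - t) ^+ 2.
  by rewrite -normcM -normcX mulrBl vt; congr normc; ring.
have h2 : normc (1 + v) * N = normc (1 + t) ^+ 2.
  by rewrite -normcM -normcX mulrDl vt; congr normc; ring.
have h3 : normc (1 - t) ^+ 2 + normc (1 + t) ^+ 2 = 2 * (1 + normc t ^+ 2).
  by rewrite !sqr_normcE; case: (t) => x y /=; ring.
have t0 := normc_ge0 t.
have D0 : 0 < normc (1 - v) + normc (1 + v).
  have := normcD (1 - v) (1 + v); rewrite addrACA addNr addr0 normc_two.
  lra.
have D1 : 0 < 1 + normc t ^+ 2 by have := sqr_ge0 (normc t); lra.
have -> : 2 * normc v / (normc (1 - v) + normc (1 + v)) =
    2 * normc t / (1 + normc t ^+ 2).
  apply/eqP; rewrite eqr_div ?(gt_eqF D0) ?(gt_eqF D1) //.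
  have N00 : N != 0 by rewrite gt_eqF.
  apply/eqP; apply: (mulIf N00).
  have -> : 2 * normc v * (1 + normc t ^+ 2) * N = 2 * (1 + normc t ^+ 2) * (normc v * N) by ring.
  have -> : 2 * normc t * (normc (1 - v) + normc (1 + v)) * N =
    2 * normc t * (normc (1 - v) * N + normc (1 + v) * N) by ring.
  by rewrite h1 h2 h3 hv; ring.
have t2 : normc t ^+ 2 < 1 by rewrite expr_lt1.
apply/andP; split.
  by rewrite ler_pdivlMr // mulrC ler_wpM2r //; lra.
rewrite ltr_pdivrMr // mul1r -subr_gt0.
have -> : 1 + normc t ^+ 2 - 2 * normc t = (1 - normc t) ^+ 2 by ring.
by rewrite exprn_gt0 // subr_gt0.
Qed.

Lemma joukowski_Im : complex.Im v * normc (1 + t ^+ 2) ^+ 2 =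
  2 * complex.Im t * (1 - normc t ^+ 2).
Proof.
rewrite !sqr_normcE; case: v t vt => b c [x y].
move=> /eqP; rewrite eq_complex /= => /andP[/eqP e1 /eqP e2].
set A := complex.Re (1 + (x +i* y) ^+ 2); set B := complex.Im (1 + (x +i* y) ^+ 2).
have AE : A = 1 + (x * x - y * y) by [].
have BE : B = 0 + (x * y + y * x) by [].
have -> : c * (A ^+ 2 + B ^+ 2) = (b * B + c * A) * A - (b * A - c * B) * B by ring.
have -> : b * A - c * B = 2 * x by rewrite e1; ring.
have -> : b * B + c * A = 2 * y by rewrite e2; ring.
by rewrite AE BE; ring.
Qed.

Lemma joukowski_Im_ge0 : 0 <= complex.Im v -> 0 <= complex.Im t.
Proof.
have t2 : normc t ^+ 2 < 1 by rewrite expr_lt1 ?normc_ge0.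
move=> v0; have := joukowski_Im; have := mulr_ge0 v0 (sqr_ge0 (normc (1 + t ^+ 2))).
move=> h hE; rewrite hE pmulr_lge0 in h; last lra.
lra.
Qed.

Lemma joukowski_Im_lt0 : complex.Im v < 0 -> complex.Im t < 0.
Proof.
have t2 : normc t ^+ 2 < 1 by rewrite expr_lt1 ?normc_ge0.
have N0 : 0 < normc (1 + t ^+ 2) ^+ 2 by rewrite exprn_gt0 // joukowski_nz.
move=> v0; have := joukowski_Im; have : complex.Im v * normc (1 + t ^+ 2) ^+ 2 < 0.
  by rewrite nmulr_rlt0.
move=> h hE; rewrite hE pmulr_llt0 in h; last lra.
lra.
Qed.

Lemma gate_Re : complex.Re (1 - 'i%C * t) = 1 + complex.Im t.
Proof. by case: t => x y /=; ring. Qed.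

Lemma gate_Re_ge0 : 0 <= complex.Re (1 - 'i%C * t).
Proof.
rewrite gate_Re; have := Im_le_normc t; rewrite ler_norml => /andP[h _].
by move: t1 h; lra.
Qed.

(** [1 - 'i * t] is small where [v] is large in the lower half-plane, since [t]
    is then close to [- 'i]. *)
Lemma gate_far : complex.Im v < 0 -> normc v * normc (1 - 'i%C * t) <= 2.
Proof.
move=> /joukowski_Im_lt0 y0.
have E : normc (1 + t ^+ 2) = normc (1 - 'i%C * t) * normc (1 + 'i%C * t).
  rewrite -normcM; congr normc.
  have -> : (1 - 'i%C * t) * (1 + 'i%C * t) = 1 - 'i%C ^+ 2 * t ^+ 2 by ring.
  by rewrite sqr_i; ring.
have h1 : 1 <= normc (1 + 'i%C * t).
  have := Re_le_normc (1 + 'i%C * t); have := ler_norm (complex.Re (1 + 'i%C * t)).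
  by case: (t) y0 => x y /= y0; lra.
have hv := joukowski_normc; rewrite E mulrA in hv.
have h0 : 0 <= normc v * normc (1 - 'i%C * t) by rewrite mulr_ge0 ?normc_ge0.
have := ler_wpM2l h0 h1; rewrite mulr1 hv.
by move: t1; lra.
Qed.

(** [1 - 'i * t] has small real part only if [t] is close to [- 'i], which
    happens only for large [v]. *)
Lemma gate_near : normc v <= 2 -> 1 / 10 <= complex.Re (1 - 'i%C * t).
Proof.
move=> v2; rewrite gate_Re.
have hv := joukowski_normc; have N0 := joukowski_nz.
have N1 : normc t <= normc (1 + t ^+ 2).
  have := ler_wpM2r (ltW N0) v2; lra.
have : normc t ^+ 2 <= normc (1 + t ^+ 2) ^+ 2.
  by rewrite ler_pXn2r ?nnegrE ?normc_ge0.
have t2 : normc t ^+ 2 < 1 by rewrite expr_lt1 ?normc_ge0.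
move: t2; rewrite !sqr_normcE; case: (t) => x y /= t2.
have -> : (1 + (x * x - y * y)) ^+ 2 + (0 + (x * y + y * x)) ^+ 2 =
   (1 + (x ^+ 2 + y ^+ 2)) ^+ 2 - 4 * y ^+ 2 by ring.
set s := x ^+ 2 + y ^+ 2 in t2 *.
have s0 : 0 <= s by rewrite addr_ge0 ?sqr_ge0.
have ys : y ^+ 2 <= s by rewrite lerDr sqr_ge0.
have : (1 + s) ^+ 2 <= 4 by nra.
rewrite leNgt => h1 h2; apply/negP => h3.
have : 81 / 100 < y ^+ 2 by nra.
lra.
Qed.

End Bounds.

(** Numerator and denominator of the convergents of the continued fraction
    [t = u / (1 - u * t)], for [u = v / 2]. *)
Fixpoint joukowski_pq (u : {poly R[i]}) n : {poly R[i]} * {poly R[i]} :=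
  if n is m.+1 then
    let: (p, q) := joukowski_pq u m in (u * q, q - u * p)
  else (0, 1).

Lemma joukowski_pqE u n z t : u.[z] * (1 + t ^+ 2) = t ->
  (joukowski_pq u n).1.[z] * (1 + t ^+ 2) ^+ n * (1 - t ^+ 2)
    = t * (1 - t ^+ (2 * n)) /\
  (joukowski_pq u n).2.[z] * (1 + t ^+ 2) ^+ n * (1 - t ^+ 2)
    = 1 - t ^+ (2 * n).+2.
Proof.
move=> uE; elim: n => [|n].
  by rewrite muln0 !expr0 /= horner0 hornerC; split; ring.
rewrite /=; case: (joukowski_pq u n) => p q /= [IHp IHq].
rewrite hornerD hornerN !hornerM; set A := 1 + t ^+ 2 in uE IHp IHq *; split.
  rewrite exprS (_ : _ * _ * _ * _ = (u.[z] * A) * (q.[z] * A ^+ n * (1 - t ^+ 2))).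
    by rewrite uE IHq mulnS.
  by ring.
rewrite exprS (_ : _ * _ * _ = A * (q.[z] * A ^+ n * (1 - t ^+ 2))
   - (u.[z] * A) * (p.[z] * A ^+ n * (1 - t ^+ 2))); last by ring.
rewrite uE IHp IHq /A mulnS !exprS; move: (t ^+ (2 * n)) => s; ring.
Qed.

(** The inverse Joukowski map [v |-> t], where [v = 2 * t / (1 + t ^+ 2)] and
    [normc t < 1], off the two real rays [normc v >= 1]. It is the limit of the
    convergents [t * (1 - t ^+ (2 * n)) / (1 - t ^+ (2 * n + 2))] of the continued
    fraction of [t], which are rational functions of [v]. *)
Lemma rapprox_joukowski Y (v : {poly R[i]}) : compact Y ->
  (forall z, Y z -> complex.Im v.[z] = 0 -> normc v.[z] < 1) ->
  exists2 t : R[i] -> R[i], rapprox Y t &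
    forall z, Y z -> normc (t z) < 1 /\ v.[z] * (1 + t z ^+ 2) = 2 * t z.
Proof.
move=> cY vY.
have /choice[t ht] : forall z, exists t,
    Y z -> normc t < 1 /\ v.[z] * (1 + t ^+ 2) = 2 * t.
  move=> z; have [Yz|nYz] := pselect (Y z); last by exists 0.
  by have [t t1 tE] := joukowski_root (vY z Yz); exists t.
exists t => // e e0.
have [Y0|nY] := pselect (Y !=set0); last first.
  exists 0, 1; split=> z Yz; first by rewrite hornerC oner_eq0.
  by case: nY; exists z.
pose E (z : R[i]) := 2 * normc v.[z] / (normc (1 - v.[z]) + normc (1 + v.[z])).
have cE : {within Y, continuous E}.
  apply: continuous_subspaceT => z; apply: (@cvgM R _ (nbhs z)).
    by apply: (@cvgM R _ (nbhs z)); [exact: cvg_cst|exact: continuous_normc_horner].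
  apply: (@cvgV R _ (nbhs z)).
    have := normcD (1 - v.[z]) (1 + v.[z]); rewrite addrACA addNr addr0 normc_two.
    by move=> h; rewrite gt_eqF //; lra.
  have -> : (fun z => normc (1 - v.[z]) + normc (1 + v.[z])) =
      (fun z => normc (1 - v).[z] + normc (1 + v).[z]).
    by apply/funext => x; rewrite !hornerD hornerN hornerC.
  have -> : normc (1 - v.[z]) + normc (1 + v.[z]) =
      normc (1 - v).[z] + normc (1 + v).[z] by rewrite !hornerD hornerN hornerC.
  by apply: (@cvgD R _ _ (nbhs z)); exact: continuous_normc_horner.
have [z0 Yz0 maxE] := compact_EVT_max Y0 cY cE.
pose kap := E z0.
have kap1 : kap < 1.
  by have [t1 tE] := ht _ (set_mem Yz0); case/andP: (joukowski_ellipse t1 tE).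
have tkap z : Y z -> normc (t z) <= kap.
  move=> Yz; have [t1 tE] := ht _ Yz; have /andP[h _] := joukowski_ellipse t1 tE.
  by apply: le_trans h _; apply: maxE; exact: mem_set.
have kap0 : 0 <= kap.
  by apply: le_trans (tkap z0 (set_mem Yz0)); exact: normc_ge0.
have kk : 0 <= kap < 1 by rewrite kap0.
have ee : 0 < e * (1 - kap) / 2 by rewrite divr_gt0 // mulr_gt0 // subr_gt0.
have [n hn] := expr_lt_eventually kk ee.
pose u : {poly R[i]} := (1 / 2)%:P * v.
have two0 : (2 : R[i]) != 0 by rewrite pnatr_eq0.
have uE z : Y z -> u.[z] * (1 + t z ^+ 2) = t z.
  move=> Yz; have [_ tE] := ht z Yz.
  rewrite /u !hornerE -mulrA tE; by field.
have nz1 (x : R[i]) : normc x < 1 -> 1 - x != 0.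
  by move=> h; apply/eqP => /eqP; rewrite subr_eq0 => /eqP xE; rewrite -xE normc1 ltxx in h.
have tn z m : Y z -> normc (t z ^+ m.+1) < 1.
  by move=> Yz; rewrite normcX exprn_ilt1 ?normc_ge0 //; case: (ht z Yz).
exists (joukowski_pq u n).1, (joukowski_pq u n).2; split=> z Yz;
  have [hp hq] := joukowski_pqE n (uE z Yz); have q0 := nz1 _ (tn z (2 * n).+1 Yz).
  by apply: contraNneq q0 => q0; rewrite -hq q0 !mul0r.
have [t1 tE] := ht z Yz.
have A0 : 1 + t z ^+ 2 != 0 by rewrite -normc_gt0 (joukowski_nz t1).
have B0 : 1 - t z ^+ 2 != 0 := nz1 _ (tn z 1 Yz).
have C0 : (1 + t z ^+ 2) ^+ n * (1 - t z ^+ 2) != 0 by rewrite mulf_neq0 // expf_neq0.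
rewrite -(mulrA _ (_ ^+ n)) in hp; rewrite -(mulrA _ (_ ^+ n)) in hq.
have -> : (joukowski_pq u n).1.[z] / (joukowski_pq u n).2.[z] =
    t z * (1 - t z ^+ (2 * n)) / (1 - t z ^+ (2 * n).+2).
  by rewrite -hp -hq invfM mulrACA (divff C0) mulr1.
have -> : t z - t z * (1 - t z ^+ (2 * n)) / (1 - t z ^+ (2 * n).+2) =
    t z ^+ n * (t z ^+ n.+1 * (1 - t z ^+ 2)) / (1 - t z ^+ (2 * n).+2).
  apply: (mulIf q0); rewrite mulrBl !divfK // !exprS mul2n -addnn exprD.
  by ring.
rewrite normcM normcV ltr_pdivrMr ?normc_gt0 // normcM.
have h1 : normc (t z ^+ n.+1 * (1 - t z ^+ 2)) <= 2.
  rewrite normcM; have := normcD 1 (- t z ^+ 2); rewrite normc1 normc_opp.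
  have := tn z n Yz; have := tn z 1%N Yz; have := normc_ge0 (t z ^+ n.+1).
  have := normc_ge0 (1 - t z ^+ 2); nra.
have h2 : 1 - kap <= normc (1 - t z ^+ (2 * n).+2).
  have := normcD (1 - t z ^+ (2 * n).+2) (t z ^+ (2 * n).+2); rewrite subrK normc1.
  rewrite (normcX _ (2 * n).+2) [X in _ + X]exprS => h3.
  have h4 : normc (t z) ^+ (2 * n).+1 <= 1 by rewrite exprn_ile1 ?normc_ge0 // ltW.
  have h5 := tkap z Yz; have h6 := normc_ge0 (t z).
  have := ler_wpM2l h6 h4; lra.
have h3 : normc (t z ^+ n) <= kap ^+ n.
  by rewrite normcX lerXn2r ?nnegrE ?normc_ge0 ?tkap.
have h4 : normc (t z ^+ n) * normc (t z ^+ n.+1 * (1 - t z ^+ 2)) <= kap ^+ n * 2.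
  by apply: ler_pM => //; exact: normc_ge0.
have h5 : e * (1 - kap) <= e * normc (1 - t z ^+ (2 * n).+2) by rewrite ler_pM2l.
lra.
Qed.

End Joukowski.

(** * Functions vanishing on a half-plane *)

Section VanishingSeries.
Variable R : realType.
Implicit Types (X : set R[i]).

Lemma real_cauchy_limit (u : nat -> R) (d : nat -> R) :
  (forall e, 0 < e -> exists N, d N < e) ->
  (forall N M, (N <= M)%N -> `|u M - u N| <= d N) ->
  exists l, forall N, `|l - u N| <= d N.
Proof.
move=> d0 ud.
have cu : cvgn u.
  apply/cauchy_cvgP; apply: cauchy_exP => e e0.
  have [N hN] := d0 e e0; exists (u N); exists N => // M /= NM.
  by rewrite -ball_normE /= distrC; apply: le_lt_trans hN; exact: ud.
exists (limn u) => N; apply/ler_addgt0Pr => e e0.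
have /cvgrPdist_lt/(_ e e0)[M _ hM] := cu.
have h1 := hM (maxn M N) (leq_maxl _ _); have h2 := ud N (maxn M N) (leq_maxr _ _).
have := ler_normD (limn u - u (maxn M N)) (u (maxn M N) - u N).
by rewrite addrA subrK; move: h1 => /=; lra.
Qed.

Lemma uniform_limit X (g : nat -> R[i] -> R[i]) (d : nat -> R) :
  (forall e, 0 < e -> exists N, d N < e) ->
  (forall N M z, (N <= M)%N -> X z -> normc (g M z - g N z) <= d N) ->
  exists f : R[i] -> R[i], forall N z, X z -> normc (f z - g N z) <= 2 * d N.
Proof.
move=> d0 gd.
have /choice[f fP] : forall z, exists y, X z -> forall N, normc (y - g N z) <= 2 * d N.
  move=> z; have [Xz|nX] := pselect (X z); last by exists 0.
  have reB (x y : R[i]) : complex.Re (x - y) = complex.Re x - complex.Re y.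
    by case: x y => ? ? [].
  have imB (x y : R[i]) : complex.Im (x - y) = complex.Im x - complex.Im y.
    by case: x y => ? ? [].
  have [|x hx] := @real_cauchy_limit (fun N => complex.Re (g N z)) d d0.
    by move=> N M NM; rewrite -reB; apply: le_trans (gd _ _ _ NM Xz); exact: Re_le_normc.
  have [|y hy] := @real_cauchy_limit (fun N => complex.Im (g N z)) d d0.
    by move=> N M NM; rewrite -imB; apply: le_trans (gd _ _ _ NM Xz); exact: Im_le_normc.
  exists (x +i* y) => _ N; apply: le_trans (normc_le_ReIm _) _.
  by rewrite reB imB /=; have := hx N; have := hy N; lra.
by exists f => N z Xz; exact: fP.
Qed.

(** The function is the limit of [1 / (1 + h_0 + ... + h_N)] for gate functions
    [h_j] supplied by the last hypothesis. Each [h_j] is chosen small on the region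
    where some predecessor is not yet large; so at every point either the tail of
    the series is small or its partial sums have large real part, and the
    convergence is uniform although the series itself diverges where [phi <= 0]. *)
Lemma rapprox_vanishing X (phi : R[i] -> R) z0 : X z0 -> 0 < phi z0 ->
  (forall tau e : R, 0 < tau -> 0 < e -> exists (g : R[i] -> R[i]) (tau' : R),
     [/\ rapprox X g, 0 < tau', forall z, X z -> 0 <= complex.Re (g z),
         forall z, X z -> phi z <= tau' -> 1 / 10 <= complex.Re (g z) &
         forall z, X z -> tau <= phi z -> normc (g z) <= e]) ->
  exists f, [/\ rapprox X f, f z0 != 0 & forall z, X z -> phi z <= 0 -> f z = 0].
Proof.
move=> Xz0 phi0 step.
(* Telescoping bounds, with tail sum [N.+1%:R^-1] from [N] on. *)
pose eps (j : nat) : R := j.+1%:R^-1 - j.+2%:R^-1.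
have eps0 j : 0 < eps j by rewrite subr_gt0 ltf_pV2 ?posrE ?ltr0n // ltr_nat.
have /choice[F FP] : forall p : nat * R, exists g : (R[i] -> R[i]) * R, 0 < p.2 ->
   [/\ rapprox X g.1, 0 < g.2, forall z, X z -> 0 <= complex.Re (g.1 z),
         forall z, X z -> phi z <= g.2 -> 1 / 10 <= complex.Re (g.1 z) &
         forall z, X z -> p.2 <= phi z -> normc (g.1 z) <= eps p.1].
  move=> [j tau] /=; have [tau0|] := ltP 0 tau; last by exists (id, 0).
  by have [g [tau' H]] := step tau (eps j) tau0 (eps0 j); exists (g, tau').
pose tau := fix tau j : R := if j is i.+1 then Num.min (tau i) (F (i, tau i)).2 else phi z0.
pose H j := (F (j, tau j)).1.
have tau0 j : 0 < tau j.
  elim: j => [|j IH] //=; rewrite lt_min IH /=.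
  by have [] := FP (j, tau j) IH.
have Hrat j : rapprox X (H j) by have [] := FP (j, tau j) (tau0 j).
have HRe j z : X z -> 0 <= complex.Re (H j z).
  by have [_ _ h _ _] := FP (j, tau j) (tau0 j); exact: h.
have Hbig j z : X z -> phi z <= tau j.+1 -> 1 / 10 <= complex.Re (H j z).
  have [_ _ _ h _] := FP (j, tau j) (tau0 j) => Xz /=.
  by rewrite le_min => /andP[_]; exact: h.
have Hsmall j z : X z -> tau j <= phi z -> normc (H j z) <= eps j.
  by have [_ _ _ _ h] := FP (j, tau j) (tau0 j); exact: h.
have tauS i j : (i <= j)%N -> tau j <= tau i.
  elim: j => [|j IH]; first by rewrite leqn0 => /eqP ->.
  rewrite leq_eqVlt => /orP[/eqP -> //|ij].
  by apply: le_trans (IH ij); rewrite /= ge_min lexx.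
pose S := fix S N (z : R[i]) : R[i] := if N is M.+1 then S M z + H M z else 0.
have Srat N : rapprox X (S N).
  by elim: N => [|N IH]; [exact: rapprox_cst|exact: rapproxD].
have ReD (x y : R[i]) : complex.Re (x + y) = complex.Re x + complex.Re y.
  by case: x y => ? ? [].
have Re1 : complex.Re (1 : R[i]) = 1 by [].
have SRe N M z : (N <= M)%N -> X z -> complex.Re (S N z) <= complex.Re (S M z).
  move=> + Xz; elim: M => [|M IH]; first by rewrite leqn0 => /eqP ->.
  rewrite leq_eqVlt => /orP[/eqP -> //|NM].
  by rewrite /= ReD; have := IH NM; have := HRe M z Xz; lra.
have SRe0 N z : X z -> 0 <= complex.Re (S N z) by move=> Xz; exact: (SRe 0%N).
have Sbig N z : X z -> phi z <= tau N -> N%:R / 10 <= complex.Re (S N z).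
  move=> Xz; elim: N => [|N IH] pz; first by rewrite mul0r.
  rewrite /= ReD -natr1; have := Hbig N z Xz pz.
  have /IH : phi z <= tau N by apply: le_trans pz _; exact: tauS.
  lra.
have Stail N M z : (N <= M)%N -> X z -> tau N <= phi z ->
    normc (S M z - S N z) <= N.+1%:R^-1 - M.+1%:R^-1.
  move=> + Xz pz; elim: M => [|M IH].
    by rewrite leqn0 => /eqP ->; rewrite !subrr normc0.
  rewrite leq_eqVlt => /orP[/eqP ->|NM]; first by rewrite !subrr normc0.
  have h1 := IH NM; have := Hsmall M z Xz (le_trans (tauS N M NM) pz).
  have := normcD (S M z - S N z) (H M z).
  rewrite addrAC /eps -[S M.+1 z]/(S M z + H M z); move: h1.
  by move: (M.+1%:R^-1) (M.+2%:R^-1) (N.+1%:R^-1) => x y u; lra.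
pose g N z : R[i] := (1 + S N z)^-1.
have grat N : rapprox X (g N).
  by apply: rapprox_inv1p => // z; exact: SRe0.
have S1 N z : X z -> 1 <= complex.Re (1 + S N z).
  by move=> Xz; rewrite ReD /=; have := SRe0 N z Xz; lra.
have Snz N z : X z -> 1 + S N z != 0.
  move=> /(S1 N); apply: contraTneq => ->; rewrite -ltNge; exact: ltr01.
have gbig N M z : (N <= M)%N -> X z -> phi z <= tau N -> normc (g M z) <= 10 / N.+1%:R.
  move=> NM Xz pz; rewrite /g normcV -[10 / _]invf_div.
  have h1 : N.+1%:R / 10 <= complex.Re (1 + S M z).
    have := Sbig N z Xz pz; have := SRe N M z NM Xz.
    rewrite ReD -[N.+1%:R]natr1 Re1; lra.
  rewrite lef_pV2 ?posrE ?normc_gt0 ?Snz ?divr_gt0 ?ltr0n //.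
  apply: le_trans h1 _; apply: le_trans (ler_norm _) _; exact: Re_le_normc.
pose d (N : nat) : R := 20 / N.+1%:R.
have d0 e : 0 < e -> exists N, d N < e.
  move=> e0; have e20 : 0 < e / 20 by lra.
  exists (Num.truncn (e / 20)^-1).
  rewrite /d ltr_pdivrMr ?ltr0n // -ltr_pdivrMl //.
  have := truncnS_gt (e / 20)^-1; rewrite invf_div; lra.
have gd N M z : (N <= M)%N -> X z -> normc (g M z - g N z) <= d N.
  move=> NM Xz; have N1 : 0 < N.+1%:R^-1 :> R by rewrite invr_gt0 ltr0n.
  have [pz|pz] := ltP (phi z) (tau N).
    have := gbig N M z NM Xz (ltW pz); have := gbig N N z (leqnn N) Xz (ltW pz).
    have := normcD (g M z) (- g N z); rewrite normc_opp /d.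
    by move: N1; move: (N.+1%:R^-1) => x; lra.
  have -> : g M z - g N z = - (S M z - S N z) * (g M z * g N z).
    by rewrite /g; field; rewrite !Snz.
  rewrite !normcM normc_opp.
  have h1 := Stail N M z NM Xz pz.
  have hM : normc (g M z) <= 1 by apply: Re_ge1_normcV; exact: S1.
  have hN : normc (g N z) <= 1 by apply: Re_ge1_normcV; exact: S1.
  have h2 : normc (g M z) * normc (g N z) <= 1.
    by rewrite mulr_ile1 ?normc_ge0.
  have := ler_wpM2l (normc_ge0 (S M z - S N z)) h2; rewrite mulr1.
  have : 0 < M.+1%:R^-1 :> R by rewrite invr_gt0 ltr0n.
  by move: h1 N1; rewrite /d; move: (N.+1%:R^-1) (M.+1%:R^-1) => x y; lra.
have [f fg] := uniform_limit d0 gd.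
exists f; split.
- apply: rapprox_lim => e e0; have e2 : 0 < e / 2 by lra.
  have [N hN] := d0 _ e2; exists (g N); first exact: grat.
  by move=> z Xz; have := fg N z Xz; lra.
- have q0 : 0 < 1 / 4 :> R by lra.
  have [N hN] := d0 _ q0.
  have h1 := Stail 0%N N z0 (leq0n N) Xz0 (lexx _).
  have h2 : normc (1 + S N z0) <= 2.
    have := normcD 1 (S N z0); rewrite normc1.
    have : 0 < N.+1%:R^-1 :> R by rewrite invr_gt0 ltr0n.
    by move: h1; rewrite subr0 invr1; move: (N.+1%:R^-1) => x; lra.
  have h3 : 1 / 2 <= normc (g N z0).
    by rewrite /g normcV div1r lef_pV2 ?posrE ?normc_gt0 ?Snz.
  rewrite -normc_gt0; have := fg N z0 Xz0.
  have := normcD (f z0) (- (f z0 - g N z0)).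
  by rewrite normc_opp opprB addrC subrK; lra.
- move=> z Xz pz; apply/eqP; rewrite -normc_eq0 eq_le normc_ge0 andbT.
  apply/ler_addgt0Pr => e e0; have e4 : 0 < e / 4 by lra.
  have [N hN] := d0 _ e4; rewrite add0r.
  have := gbig N N z (leqnn N) Xz (le_trans pz (ltW (tau0 N))).
  have := fg N z Xz; have := normcD (f z - g N z) (g N z); rewrite subrK.
  have N1 : 0 < N.+1%:R^-1 :> R by rewrite invr_gt0 ltr0n.
  by move: N1 hN; rewrite /d; move: (N.+1%:R^-1) => x; lra.
Qed.

End VanishingSeries.

(** * Gate functions of the slits *)

Section Gates.
Variables (R : realType) (a : nat -> R) (x0 h : R).
Hypothesis a_incr : forall n, a n < a n.+1.
Hypothesis a_cvg : a n @[n --> \oo] --> x0.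
Hypothesis h_gt0 : 0 < h.
Variables (l r : nat -> nat -> R) (w : nat -> nat -> R[i]).
Hypothesis slits : forall n, slit_sequence a x0 h n (l n) (r n) (w n).
Implicit Types (z y : R[i]).

Let X : set R[i] := slitX a x0 h l r w.
Let K n : set R[i] := slitK a x0 h n (l n) (r n) (w n).

Section OneGate.
Variables n k : nat.
Let p := slope a x0 h (l n k).
Let q := slope a x0 h (r n k).
Let tip := w n k.
Let mid := (l n k + r n k) / 2.
Let b := slope a x0 h mid.
Hypothesis tip_below : complex.Im tip < complex.Im b.

(** The scale that puts the lower end [tip - D] of the gate at height
    [- Im tip], below the big triangle. *)
Let lam := 2 * complex.Im tip / (complex.Im b - complex.Im tip).
Let D : R[i] := lam%:C * (b - tip).

(** A compact set containing [X], cut out so that the line through the tip and the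
    middle of the base meets it only near the tip: on the slit side of the tip both
    barycentric coordinates are positive, on the other side the big triangle ends
    within distance [normc D] of the tip. *)
Definition gate_region : set R[i] := [set z | bigT a x0 h z /\
  (bary p q tip z <= 0 \/ bary q tip p z <= 0)].

Let nd : cross (q - p) (tip - p) != 0.
Proof. exact: (slit_ndeg a_incr a_cvg h_gt0 (slits n) k). Qed.

Let nd' : cross (tip - q) (p - q) != 0.
Proof. by rewrite cross_cycle. Qed.

Let tip_gt0 : 0 < complex.Im tip.
Proof. by have [] := tipP a_incr a_cvg h_gt0 (slits n) k. Qed.

Let lam_gt0 : 0 < lam.
Proof. by rewrite divr_gt0 ?mulr_gt0 // subr_gt0. Qed.

Let bE : b = (1 / 2)%:C * p + (1 / 2)%:C * q + 0%:C * tip.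
Proof.
rewrite rmorph0 mul0r addr0; apply/eqP; rewrite eq_complex /=.
have L := base_gt0 a_incr a_cvg.
by rewrite /mid !mul0r !subr0 !addr0; apply/andP; split; apply/eqP; field; rewrite ?gt_eqF.
Qed.

Let D_neq0 : D != 0.
Proof.
rewrite mulf_neq0 ?fmorph_eq0 ?(gt_eqF lam_gt0) //.
by apply/eqP => /eqP; rewrite subr_eq0 => /eqP bt; move: tip_below; rewrite bt ltxx.
Qed.

Let ImD : complex.Im D = 2 * complex.Im tip.
Proof.
have -> : complex.Im D = lam * (complex.Im b - complex.Im tip).
  by rewrite /D; case: (b) (tip) => ? ? [? ?] /=; ring.
by rewrite /lam divfK // gt_eqF // subr_gt0.
Qed.

Lemma gate_region_real z : gate_region z ->
  complex.Im ((z - tip) / D) = 0 -> normc ((z - tip) / D) < 1.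
Proof.
move=> [Tz side]; set v := (z - tip) / D => v0.
have vE : v = (complex.Re v)%:C by case: (v) v0 => x y /= ->.
have zE : z = tip + (complex.Re v * lam)%:C * (b - tip).
  rewrite rmorphM /= -vE -mulrA -/D /v divfK // addrC subrK //.
have [bp bq _] : [/\ bary p q tip b = 1 / 2, bary q tip p b = 1 / 2 & bary tip p q b = 0].
  by rewrite bE; apply: bary_comb => //; lra.
have [_ _ pt] := bary_vertex nd; have [_ qt _] := bary_vertex nd'.
rewrite vE normc_real ltr_norml; apply/andP; split; rewrite ltNge; apply/negP => h1.
- have /(bigTP a_incr a_cvg h_gt0)[_ + _] := Tz.
  have -> : complex.Im z = complex.Im tip + complex.Re v * complex.Im D.
    by rewrite {1}zE /D; case: (b) (tip) => ? ? [? ?] /=; ring.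
  by rewrite ImD; have := tip_gt0; nra.
- have : 0 < complex.Re v * lam by rewrite mulr_gt0 //; lra.
  by case: side; rewrite zE bary_shift ?bp ?bq ?pt ?qt; lra.
Qed.

Lemma compact_gate_region : compact gate_region.
Proof.
have cT : compact (bigT a x0 h).
  apply: compact_triangle; rewrite /cross /= (_ : _ - _ = - (h * (x0 - a 0))); last by ring.
  by rewrite oppr_eq0 mulf_neq0 // gt_eqF // base_gt0.
apply: (subclosed_compact _ cT); last by move=> z [].
rewrite (_ : gate_region = bigT a x0 h `&` ([set z | bary p q tip z <= 0] `|`
    [set z | bary q tip p z <= 0])).
  apply: closedI; first by apply: compact_closed => //; exact: norm_hausdorff.
  by apply: closedU; apply: closed_le_continuous; exact: continuous_bary.
by [].
Qed.

Lemma slitX_gate_region : X `<=` gate_region.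
Proof.
move=> z Xz.
have Tz : bigT a x0 h z.
  case: Xz => [->|[m _ [[]]] //]; apply/(bigTP a_incr a_cvg h_gt0).
  rewrite /depth /top /= !subrr mulr0 mul0r.
  by split=> //; apply: ltW; exact: a_lt_lim.
split=> //; have [?|b1] := leP (bary p q tip z) 0; first by left.
have [?|b2] := leP (bary q tip p z) 0; first by right.
exfalso.
have /(bigTP a_incr a_cvg h_gt0)[_ _ dz] := Tz.
have rz := slit_removedP a_incr a_cvg h_gt0 (slits n) b1 b2 dz.
have [z1 z2 _ _] := slit_strip a_incr a_cvg h_gt0 (slits n) (slit_removed_sub rz).
case: Xz => [zE|[m _ [/(trapezoidP a_incr a_cvg h_gt0)[m1 m2 _ _] nr]]].
  by have := a_lt_lim a_incr a_cvg n.+1; move: z2; rewrite zE /=; lra.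
have [mn|nm|mn] := ltngtP m n.
- have := a_le a_incr mn; lra.
- have := a_le a_incr nm; lra.
- by apply: nr; rewrite mn; exists k.
Qed.

Lemma gate_function : exists2 g : R[i] -> R[i], rapprox X g &
  forall z, X z -> exists t, [/\ normc t < 1,
    (z - tip) / D * (1 + t ^+ 2) = 2 * t & g z = 1 - 'i%C * t].
Proof.
pose v : {poly R[i]} := D^-1 *: ('X - tip%:P).
have vE z : v.[z] = (z - tip) / D by rewrite /v !hornerE mulrC.
have [|t tY tP] := rapprox_joukowski compact_gate_region (v := v).
  by move=> z; rewrite vE; exact: gate_region_real.
exists (fun z => 1 + (- 'i%C) * t z).
  apply: rapproxD; first exact: rapprox_cst.
  by apply: rapproxZ; apply: rapprox_subset tY; exact: slitX_gate_region.
move=> z /slitX_gate_region /tP[t1 tE]; exists (t z).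
by split; rewrite ?mulNr // -vE.
Qed.

Let ReD : complex.Re D = lam * (mid - complex.Re tip).
Proof. by rewrite /D; case: (tip) => ? ? /=; ring. Qed.

Let ImDE : complex.Im D = lam * (complex.Im b - complex.Im tip).
Proof. by rewrite /D; case: (b) (tip) => ? ? [? ?] /=; ring. Qed.

(** Up to a positive factor, the signed distance from [z] to the line of the
    gate. *)
Definition gate_side z := (complex.Im z - complex.Im tip) * (mid - complex.Re tip)
  - (complex.Re z - complex.Re tip) * (complex.Im b - complex.Im tip).

Lemma Im_gate z : complex.Im ((z - tip) / D) * normc D ^+ 2 = lam * gate_side z.
Proof.
rewrite Im_quotient // ReD ImDE /gate_side.
by case: (z) (tip) => ? ? [? ?] /=; ring.
Qed.

Let D_gt0 : 0 < normc D ^+ 2.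
Proof. by rewrite exprn_gt0 // normc_gt0. Qed.

(** A point to the left of the slit lies either to the left of the line of the
    gate, or close to the gate: if the line leans to the right, the points on its
    right are lower than the tip; if it leans to the left, the hypotenuse keeps
    them from being above the slit. *)
Lemma gate_left z : X z -> complex.Re z <= mid -> complex.Re z <= complex.Re tip ->
  mid - complex.Re tip <= complex.Im b - complex.Im tip ->
  0 <= complex.Im ((z - tip) / D) \/ normc ((z - tip) / D) <= 2.
Proof.
move=> /slitX_gate_region[/(bigTP a_incr a_cvg h_gt0)[_ z0 dz] _] zm zt slope1.
have [_ _ _ dt] := tipP a_incr a_cvg h_gt0 (slits n) k.
have D1 := D_gt0; have t0 := tip_gt0.
have [N0|N0] := lerP 0 (gate_side z).
  left; rewrite -(pmulr_lge0 _ D1) Im_gate; exact: mulr_ge0 (ltW lam_gt0) N0.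
right; have dist : normc (z - tip) <= 2 * complex.Im tip.
  apply: le_trans (normc_le_ReIm _) _.
  have -> : complex.Re (z - tip) = complex.Re z - complex.Re tip.
    by case: (z) (tip) => ? ? [].
  have -> : complex.Im (z - tip) = complex.Im z - complex.Im tip.
    by case: (z) (tip) => ? ? [].
  rewrite (ler0_norm (_ : complex.Re z - _ <= 0)) ?subr_le0 //.
  have hb : complex.Im b = top a x0 h mid by [].
  have h1 := @top_slope R a x0 h a_incr a_cvg (complex.Re z) mid.
  have h2 := @top_slope R a x0 h a_incr a_cvg (complex.Re tip) mid.
  have bt := tip_below.
  have kap : 0 < h / (x0 - a 0) by rewrite divr_gt0 // base_gt0.
  move: N0 dz dt slope1 bt; rewrite /gate_side /depth hb.
  move: h1 h2 kap; rewrite -/tip; move: (h / (x0 - a 0)) => kap.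
  move: (top a x0 h (complex.Re z)) (top a x0 h (complex.Re tip)) => tz tt.
  move: (top a x0 h mid) (complex.Re z) (complex.Im z) zm zt z0 => tm x y zm zt z0.
  move: (complex.Re tip) (complex.Im tip) zt t0 => wx wy zt t0 h1 h2 k0 N0 dz dt s1 bt.
  have [c|c] := lerP mid wx.
    exfalso.
    have e1 : tm - wy - kap * (wx - mid) > 0 by nra.
    have e2 : y <= tm + kap * (mid - x) by lra.
    have : 0 <= (mid - x) * (tm - wy - kap * (wx - mid)).
      by rewrite mulr_ge0 //; lra.
    have : (tm + kap * (mid - x) - y) * (mid - wx) <= 0.
      by rewrite mulr_ge0_le0 //; lra.
    nra.
  have yw : y < wy.
    rewrite ltNge; apply/negP => yw.
    have : 0 <= (y - wy) * (mid - wx) by rewrite mulr_ge0 //; lra.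
    have : 0 <= (wx - x) * (tm - wy) by rewrite mulr_ge0 //; lra.
    lra.
  have xw : wx - x < wy.
    have u1 : (wx - x) * (tm - wy) < (wy - y) * (mid - wx) by lra.
    have u2 : (wy - y) * (mid - wx) <= wy * (tm - wy).
      by apply: ler_pM; lra.
    rewrite -(ltr_pM2r (_ : 0 < tm - wy)); lra.
  rewrite ler0_norm; lra.
rewrite normcM normcV ler_pdivrMr ?normc_gt0 //.
have := Im_le_normc D; rewrite ImD gtr0_norm; last by rewrite mulr_gt0.
have := normc_ge0 D; lra.
Qed.

(** Far to the right of the gate [Im v] is negative and of order [1 / lam], with
    constants independent of the slit, so that [gate_far] applies. *)
Lemma gate_right z (tau d : R) : X z -> 0 < tau ->
  a n + tau <= complex.Re z -> mid < a n + d -> complex.Re tip < a n + d ->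
  complex.Im tip < d -> d <= 1 -> d <= tau / 2 ->
  top a x0 h (a n) / 2 <= complex.Im b - complex.Im tip ->
  h * d <= tau * top a x0 h (a n) / 8 ->
  complex.Im ((z - tip) / D) < 0 /\
  tau * top a x0 h (a n) / (8 * (1 + h ^+ 2)) <= lam * normc ((z - tip) / D).
Proof.
move=> /slitX_gate_region[/(bigTP a_incr a_cvg h_gt0)[za z0 dz] _] tau0 zt md td tipd.
move=> d1 dtau Hb hd.
have [t1 _ t3 _] := tipP a_incr a_cvg h_gt0 (slits n) k.
have [l1 l2 _] := slit_ends a_incr a_cvg h_gt0 (slits n) k.
have ma : a n < mid by rewrite /mid; lra.
have toph s : a 0 <= s -> top a x0 h s <= h.
  move=> s0; have L := base_gt0 a_incr a_cvg.
  have hE : top a x0 h (a 0) = h by rewrite /top mulfK // gt_eqF.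
  rewrite -[leRHS]hE -subr_ge0 (@top_slope R a x0 h a_incr a_cvg).
  by rewrite mulr_ge0 ?subr_ge0 // divr_ge0 // ltW.
have an0 := a_le a_incr (leq0n n).
have H0 : 0 < top a x0 h (a n) by apply: top_gt0 => //; exact: a_lt_lim.
have by_le : complex.Im b <= h by apply: toph; lra.
have y_le : complex.Im z <= h by have := toph _ za; move: dz; rewrite /depth; lra.
have side : gate_side z <= - (tau * top a x0 h (a n) / 8).
  have e1 : (complex.Im z - complex.Im tip) * (mid - complex.Re tip) <= h * d.
    apply: le_trans (ler_norm _) _; rewrite normrM; apply: ler_pM => //.
      by rewrite ler_norml; move: t3; rewrite -/tip; lra.
    by rewrite ler_norml; move: t1 td; rewrite -/tip; lra.
  have e2 : tau / 2 * (top a x0 h (a n) / 2) <=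
      (complex.Re z - complex.Re tip) * (complex.Im b - complex.Im tip).
    by apply: ler_pM; lra.
  rewrite /gate_side; lra.
have tH : 0 < tau * top a x0 h (a n) by rewrite mulr_gt0.
have D1 := D_gt0; have IE := Im_gate z; have l0 := lam_gt0.
have v0 : complex.Im ((z - tip) / D) < 0.
  rewrite -(pmulr_llt0 _ D1) IE pmulr_rlt0 //; lra.
split=> //; rewrite ler_pdivrMr; last by have := sqr_ge0 h; lra.
have bD : normc D ^+ 2 <= lam ^+ 2 * (1 + h ^+ 2).
  rewrite sqr_normcE ReD ImDE.
  have -> : (lam * (mid - complex.Re tip)) ^+ 2 +
      (lam * (complex.Im b - complex.Im tip)) ^+ 2 = lam ^+ 2 *
      ((mid - complex.Re tip) ^+ 2 + (complex.Im b - complex.Im tip) ^+ 2) by ring.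
  apply: ler_wpM2l; first exact: sqr_ge0.
  apply: lerD.
    rewrite -[leLHS]real_normK ?num_real // expr_le1 ?normr_ge0 //.
    by rewrite ler_norml; move: t1 td; rewrite -/tip; lra.
  by rewrite lerXn2r ?nnegrE //; move: t3; rewrite -/tip; lra.
have iv : - complex.Im ((z - tip) / D) <= normc ((z - tip) / D).
  by have := Im_le_normc ((z - tip) / D); rewrite ler0_norm // ltW.
have e3 : lam * (tau * top a x0 h (a n) / 8) <=
    - complex.Im ((z - tip) / D) * (lam ^+ 2 * (1 + h ^+ 2)).
  apply: le_trans (_ : - complex.Im ((z - tip) / D) * normc D ^+ 2 <= _); last first.
    by rewrite ler_wpM2l // oppr_ge0 ltW.
  by rewrite mulNr IE -mulrN ler_pM2l //; lra.
have e4 : - complex.Im ((z - tip) / D) * (lam ^+ 2 * (1 + h ^+ 2)) <=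
    normc ((z - tip) / D) * (lam ^+ 2 * (1 + h ^+ 2)).
  by rewrite ler_wpM2r // mulr_ge0 ?sqr_ge0 //; have := sqr_ge0 h; lra.
have := le_trans e3 e4.
have -> : normc ((z - tip) / D) * (lam ^+ 2 * (1 + h ^+ 2)) =
  lam * (lam * normc ((z - tip) / D) * (1 + h ^+ 2)) by ring.
by rewrite ler_pM2l //; lra.
Qed.

Lemma gate_width : lam * (complex.Im b - complex.Im tip) = 2 * complex.Im tip.
Proof. by rewrite -ImDE ImD. Qed.

End OneGate.

(** The gates of one piece shrink to the lower left corner, so the gate functions
    tend to [0] locally uniformly to the right of the left edge, while keeping a
    definite real part to its left. *)
Lemma exists_gate n (tau e : R) : 0 < tau -> 0 < e ->
  exists (g : R[i] -> R[i]) (tau' : R), [/\ rapprox X g, 0 < tau',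
    forall z, X z -> 0 <= complex.Re (g z),
    forall z, X z -> complex.Re z - a n <= tau' -> 1 / 10 <= complex.Re (g z) &
    forall z, X z -> tau <= complex.Re z - a n -> normc (g z) <= e].
Proof.
move=> tau0 e0; have L := base_gt0 a_incr a_cvg.
pose H := top a x0 h (a n).
have H0 : 0 < H by apply: top_gt0 => //; exact: a_lt_lim.
pose C := 1 + h ^+ 2; have C0 : 0 < C by rewrite /C; have := sqr_ge0 h; lra.
pose kap := h / (x0 - a 0); have kap0 : 0 < kap by rewrite divr_gt0.
have tH : 0 < tau * H by rewrite mulr_gt0.
pose d := Num.min (Num.min (Num.min 1 (tau / 2)) (Num.min (H / 4) (H / (4 * kap))))
  (Num.min (tau * H / (8 * h)) (e * (tau * H * H) / (64 * C))).
have d0 : 0 < d.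
  rewrite !lt_min ltr01 /=; do ?[apply/andP; split];
    by rewrite ?(divr_gt0, mulr_gt0) // subr_gt0; exact: a_lt_lim.
have [d1 d2 [d3 d4 d5 d6]] : [/\ d <= 1, d <= tau / 2 & [/\ d <= H / 4,
   d <= H / (4 * kap), d <= tau * H / (8 * h) & d <= e * (tau * H * H) / (64 * C)]].
  by rewrite /d !ge_min !lexx !orbT; do ?split.
have [N hN] := slit_base_cvg (slits n) d0.
have [rd wd Rewd] := hN N (leqnn N).
have [l1 l2 _] := slit_ends a_incr a_cvg h_gt0 (slits n) N.
have [t1 t2 t3 t4] := tipP a_incr a_cvg h_gt0 (slits n) N.
pose mid := (l n N + r n N) / 2.
have ma : a n < mid by rewrite /mid; lra.
have md : mid < a n + d by rewrite /mid; lra.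
have wy : complex.Im (w n N) < d.
  have := le_lt_trans (Im_le_normc _) wd; rewrite ltr_norml.
  by case: (w n N) => x y /= /andP[_]; lra.
have topm : H - H / 4 <= top a x0 h mid.
  have := @top_slope R a x0 h a_incr a_cvg (a n) mid; rewrite -/H -/kap => hm.
  have : kap * (mid - a n) <= kap * (H / (4 * kap)) by rewrite ler_wpM2l // ?ltW //; lra.
  have -> : kap * (H / (4 * kap)) = H / 4 by field; rewrite gt_eqF.
  lra.
have below : complex.Im (w n N) < complex.Im (slope a x0 h mid).
  by rewrite -[complex.Im (slope _ _ _ _)]/(top a x0 h mid); lra.
have [g gX gP] := gate_function below.
exists g, (Num.min mid (complex.Re (w n N)) - a n); split=> //.
- by rewrite subr_gt0 lt_min ma.
- by move=> z /gP[t [tt vt ->]]; exact: gate_Re_ge0 tt.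
- move=> z Xz; rewrite lerD2r le_min => /andP[z1 z2].
  have [t [tt vt ->]] := gP z Xz.
  have sl : mid - complex.Re (w n N) <=
      complex.Im (slope a x0 h mid) - complex.Im (w n N).
    rewrite -[complex.Im (slope _ _ _ _)]/(top a x0 h mid); lra.
  have [vi|vn] := gate_left below Xz z1 z2 sl; last exact: gate_near tt vt vn.
  by rewrite gate_Re; have := joukowski_Im_ge0 tt vt vi; lra.
- move=> z Xz z1; have [t [tt vt ->]] := gP z Xz.
  have Hb : top a x0 h (a n) / 2 <= complex.Im (slope a x0 h mid) - complex.Im (w n N).
    rewrite -[complex.Im (slope _ _ _ _)]/(top a x0 h mid) -/H; lra.
  have hd : h * d <= tau * top a x0 h (a n) / 8.
    move: d5; rewrite ler_pdivlMr ?mulr_gt0 // -/H; lra.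
  have z1' : a n + tau <= complex.Re z by lra.
  have [vi vn] := gate_right below Xz tau0 z1' md Rewd wy d1 d2 Hb hd.
  have gw := gate_width below.
  move: vi vn vt gw; set lam := 2 * _ / _; set v := _ / _ => vi vn vt gw.
  have far := gate_far tt vt vi.
  have lam0 : 0 < lam.
    by rewrite divr_gt0 ?mulr_gt0 // subr_gt0.
  have G0 := normc_ge0 (1 - 'i%C * t); set G := normc (1 - 'i%C * t) in far G0 *.
  have lamH : lam * (H / 2) <= 2 * d.
    apply: le_trans (_ : lam * (complex.Im (slope a x0 h mid) - complex.Im (w n N)) <= _).
      by rewrite ler_wpM2l // ltW.
    by rewrite gw; lra.
  have e1 : tau * H / (8 * C) * G <= 2 * lam.
    have := ler_wpM2r G0 vn; rewrite -/H -/C.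
    have := ler_wpM2l (ltW lam0) far; lra.
  have e2 : tau * H / (8 * C) * G * (H / 2) <= 4 * d.
    have := ler_wpM2r (_ : 0 <= H / 2) e1 => /(_ _); lra.
  have e3 : tau * H / (8 * C) * G * (H / 2) = (tau * H * H) / (64 * C) * (4 * G).
    by field; rewrite gt_eqF.
  have P0 : 0 < tau * H * H / (64 * C) by apply: divr_gt0; [exact: mulr_gt0 tH H0|exact: mulr_gt0].
  have e4 : tau * H * H / (64 * C) * (4 * G) <= tau * H * H / (64 * C) * (4 * e).
    rewrite -e3; lra.
  by move: e4; rewrite ler_pM2l //; lra.
Qed.

(** A function of [R(X)] separating [x0] from everything left of the [n]-th
    vertical edge. *)
Lemma exists_peak n : exists f, [/\ rapprox X f, f (x0 +i* 0) != 0 &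
  forall z, X z -> complex.Re z <= a n -> f z = 0].
Proof.
have [|||f [f1 f2 f3]] := @rapprox_vanishing R X (fun z => complex.Re z - a n) (x0 +i* 0).
- by left.
- by rewrite /= subr_gt0; exact: a_lt_lim.
- by move=> tau e; exact: exists_gate.
- by exists f; split=> // z Xz za; apply: f3 => //; rewrite subr_le0.
Qed.

End Gates.

(** * Points of continuity and R-points *)

Section SlitK.
Variables (R : realType) (a : nat -> R) (x0 h : R).
Hypothesis a_incr : forall n, a n < a n.+1.
Hypothesis a_cvg : a n @[n --> \oo] --> x0.
Hypothesis h_gt0 : 0 < h.
Variables (l r : nat -> nat -> R) (w : nat -> nat -> R[i]).
Hypothesis slits : forall n, slit_sequence a x0 h n (l n) (r n) (w n).

Lemma vedge_slitK n : vedge a x0 h n `<=` slitK a x0 h n (l n) (r n) (w n).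
Proof.
move=> z [/(bigTP a_incr a_cvg h_gt0)[z1 z2 z3] zE]; split.
  apply/(trapezoidP a_incr a_cvg h_gt0); rewrite zE; split=> //.
  exact: ltW.
move=> [k _ /slit_removed_sub Sz].
have [zn _ _ _] := slit_strip a_incr a_cvg h_gt0 (slits n) Sz.
by rewrite zE ltxx in zn.
Qed.

Lemma corner_vedge n : vedge a x0 h n (a n +i* 0).
Proof.
split=> //; apply/(bigTP a_incr a_cvg h_gt0); split=> //=.
  exact: a_le.
by rewrite /depth /= subr0 ltW // (top_gt0 a_incr a_cvg) // (a_lt_lim a_incr a_cvg).
Qed.

Lemma slitK_other_point n (x : R[i]) :
  exists2 y, slitK a x0 h n (l n) (r n) (w n) y & y <> x.
Proof.
have [->|xc] := eqVneq x (a n +i* 0); last first.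
  exists (a n +i* 0); first exact: vedge_slitK (@corner_vedge n).
  by move/esym/eqP; rewrite (negbTE xc).
exists (slope a x0 h (a n)).
  by apply: vedge_slitK; exact: slope_vedge.
move=> /(congr1 (@complex.Im R)) /= H.
have := top_gt0 a_incr a_cvg h_gt0 (a_lt_lim a_incr a_cvg n).
by rewrite /top H ltxx.
Qed.

End SlitK.

Unset Implicit Arguments.

Theorem theorem3p4 (R : realType) (a : nat -> R) (x0 h : R)
    (a_incr : forall n, a n < a n.+1)
    (a_cvg : a n @[n --> \oo] --> x0)
    (h_gt0 : 0 < h)
    (l r : nat -> nat -> R) (w : nat -> nat -> R[i])
    (slits : forall n, slit_sequence a x0 h n (l n) (r n) (w n)) :
  [set x | point_of_continuity (slitX a x0 h l r w) x] = [set x0 +i* 0] /\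
  (forall x, ~ R_point (slitX a x0 h l r w) x).
Proof.
set X := slitX a x0 h l r w.
have KX n : slitK a x0 h n (l n) (r n) (w n) `<=` X by exact: slitK_sub.
have idealJ_zero y f : idealJ X y f -> ratfun X f /\ zero_near a x0 h l r w f y.
  by move=> [fX /within_normcP fy].
have J_sub_M n x y : slitK a x0 h n (l n) (r n) (w n) x ->
    slitK a x0 h n (l n) (r n) (w n) y -> idealJ X x `<=` idealM X y.
  move=> Kx Ky f /idealJ_zero[fX zx]; split=> //.
  exact: (zero_on_slitK a_incr a_cvg h_gt0 slits fX Kx zx Ky).
have Xx0 : X (x0 +i* 0) by left.
split; [apply/seteqP; split=> x /=|move=> x].
- move=> [Xx cx]; case: (Xx) => // -[n _ Kx]; exfalso.
  have [y Ky yx] := slitK_other_point a_incr a_cvg h_gt0 slits n x.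
  exact: (cx y (KX _ _ Ky) yx (J_sub_M n y x Ky Kx)).
- move=> ->; split=> // y [//|[m _ [/(trapezoidP a_incr a_cvg h_gt0)[_ ym _ _] _]]] _ JM.
  have [f [fX fx0 f0]] := exists_peak a_incr a_cvg h_gt0 slits m.+2.
  have [_ /eqP] : idealM X (x0 +i* 0) f.
    apply: JM; split; first exact/ratfunP.
    have am := a_incr m.+1; apply/within_normcP.
    exists (a m.+2 - a m.+1); first by rewrite subr_gt0.
    move=> z Xz zy; apply: f0 => //.
    have := le_lt_trans (Re_le_normc _) zy; rewrite ltr_norml => /andP[_].
    by case: (z) (y) ym => ? ? [? ?] /=; lra.
  by rewrite (negbTE fx0).
- move=> [Xx rx]; case: (Xx) => [xE|[n _ Kx]]; last first.
    have [y Ky yx] := slitK_other_point a_incr a_cvg h_gt0 slits n x.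
    exact: (rx y (KX _ _ Ky) yx (J_sub_M n x y Kx Ky)).
  rewrite xE in rx.
  have K0 := vedge_slitK a_incr a_cvg h_gt0 slits (corner_vedge a_incr a_cvg h_gt0 0).
  apply: (rx (a 0%N +i* 0)); first exact: KX K0.
    by move=> /(congr1 (@complex.Re R)) /= E; have := a_lt_lim a_incr a_cvg 0%N; rewrite E ltxx.
  move=> f /idealJ_zero[fX [e e0 he]]; split=> //.
  have /cvgrPdist_lt/(_ e e0)[n _ hn] := a_cvg.
  have {}hn := hn n (leqnn n).
  have Kn := vedge_slitK a_incr a_cvg h_gt0 slits (corner_vedge a_incr a_cvg h_gt0 n).
  apply: (zero_on_earlier_slitK a_incr a_cvg h_gt0 slits fX (leq0n n) Kn _ K0).
  have xn : normc ((a n +i* 0) - (x0 +i* 0)) = `|x0 - a n|.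
    by rewrite /= subr0 expr0n addr0 sqrtr_sqr distrC.
  rewrite /= in hn.
  exists (e - `|x0 - a n|); first by rewrite subr_gt0.
  move=> z Xz zn; apply: he => //.
  have := normcD (z - (a n +i* 0)) ((a n +i* 0) - (x0 +i* 0)); rewrite subrKA xn; lra.
Qed.
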